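(* Let $d\ge1$ and let $f\in R_d=\mathbb{Z}[z_1^{\pm1},\dots,z_d^{\pm1}]$ be a primitive irreducible polynomial with positive Mahler measure $\mathsf{m}(f)>0$. If $f$ is $m$-good for some positive integer $m$, then $(X_f,\alpha_f)$ is Bohr chaotic.
   Context: $\mathbb{N}=\{0,1,2,\dots\}$, $\mathbb{T}=\mathbb{R}/\mathbb{Z}$, $\boldsymbol z^{\boldsymbol n}=z_1^{n_1}\cdots z_d^{n_d}$. A nonzero $f\in R_d$ is primitive if the gcd of its coefficients is $1$, and irreducible if it is not a product of two non-units of $R_d$. The Mahler measure is $\mathsf{m}(f)=\int_{[0,1]^d}\log|f(e^{2\pi it_1},\dots,e^{2\pi it_d})|\,dt_1\cdots dt_d$. $m$-good: for a positive integer $m$, a primitive irreducible $f\in R_d$ is $m$-good if the following two conditions hold, where all sums are finitely supported and divisibility is in $R_d$; for $g(\boldsymbol z)=\sum_{\boldsymbol n}\varepsilon_{\boldsymbol n}\boldsymbol z^{\boldsymbol n}$ we write $g(\boldsymbol z^m)=\sum_{\boldsymbol n}\varepsilon_{\boldsymbol n}\boldsymbol z^{m\boldsymbol n}$. (C1) No nonzero polynomial of the form $g(\boldsymbol z^m)$, with $g(\boldsymbol z)=\sum_{\boldsymbol n\in\mathbb{Z}^d}\varepsilon_{\boldsymbol n}\boldsymbol z^{\boldsymbol n}$ and all $\varepsilon_{\boldsymbol n}\in\{-2,-1,0,1,2\}$, is divisible by $f$. (C2) For every $\boldsymbol k\in\{0,\dots,m-1\}^d\smallsetminus\{\boldsymbol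 0\}$, any two points $\boldsymbol n\ne\boldsymbol n'$ in $\mathbb{Z}^d$, and any nonzero $g(\boldsymbol z)=\sum_{\boldsymbol l\in\mathbb{Z}^d}\varepsilon_{\boldsymbol l}\boldsymbol z^{\boldsymbol l}$ with all $\varepsilon_{\boldsymbol l}\in\{-1,0,1\}$, the polynomial $\boldsymbol z^{m\boldsymbol n+\boldsymbol k}-\boldsymbol z^{m\boldsymbol n'+\boldsymbol k}+g(\boldsymbol z^m)$ is not divisible by $f$. Principal algebraic $\mathbb{Z}^d$-action: for nonzero $f=\sum_{\boldsymbol n}f_{\boldsymbol n}\boldsymbol z^{\boldsymbol n}\in R_d$, $X_f=\{x\in\mathbb{T}^{\mathbb{Z}^d} : \sum_{\boldsymbol m}f_{\boldsymbol m}x_{\boldsymbol n+\boldsymbol m}=0\text{ in }\mathbb{T}\text{ for all }\boldsymbol n\in\mathbb{Z}^d\}$ and $\alpha_f$ is the restriction to $X_f$ of the shift action $(\sigma^{\boldsymbol m}x)_{\boldsymbol n}=x_{\boldsymbol n+\boldsymbol m}$ of $\mathbb{Z}^d$. Bohr chaoticity: a non-trivial weight is a bounded complex family $w=(w_{\boldsymbol n})_{\boldsymbol n\in\mathbb{N}^d}$ with $\limsup_{N\to\infty}\frac1{N^d}\sum_{\boldsymbol n\in[0,N-1]^d}|w_{\boldsymbol n}|>0$. A continuous $\mathbb{Z}^d$-action $\alpha$ on a compact space $X$ is Bohr chaotic if for every non-trivial weight $w$ there exist $h\in C(X)$ and $x\in X$ with $\limsup_{N\to\infty}\frac1{N^d}\bigl|\sum_{\boldsymbol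 n\in[0,N-1]^d}w_{\boldsymbol n}\,h(\alpha^{\boldsymbol n}x)\bigr|>0$. *)

(* Defs.v *)
From HB Require Import structures.
From mathcomp Require Import all_boot all_order all_algebra finmap.
From mathcomp Require Import all_classical all_reals all_analysis.
From mathcomp Require Import complex ring_quotient.
Set Implicit Arguments.
Unset Strict Implicit.
Unset Printing Implicit Defensive.
Import Order.TTheory GRing.Theory Num.Theory.
Import numFieldNormedType.Exports.
Local Open Scope classical_set_scope.
Local Open Scope ring_scope.

(* The ring Z[z_1^{+-1}, ..., z_d^{+-1}]: a Laurent polynomial is the finitely
   supported family of its coefficients, and f n is the coefficient of z^n. *)
Definition laurent (d : nat) : Type := {fsfun 'rV[int]_d -> int with 0}.
HB.instance Definition _ d := Choice.on (laurent d).

Section LaurentRing.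
Local Open Scope fset_scope.
Local Open Scope ring_scope.
Context {d : nat}.
Implicit Types (f g h : laurent d) (n k : 'rV[int]_d) (S : {fset 'rV[int]_d}).

Lemma laurentP f g : (forall n, f n = g n) <-> f = g.
Proof. exact: fsfunP. Qed.

Definition laurent_of S (c : 'rV[int]_d -> int) : laurent d :=
  [fsfun n in S => c n].

Lemma laurent_ofE S c n : laurent_of S c n = if n \in S then c n else 0.
Proof. by rewrite /laurent_of fsfunE. Qed.

Lemma laurent_out f S n : finsupp f `<=` S -> n \notin S -> f n = 0.
Proof. by move=> /fsubsetP sS nS; apply: fsfun_dflt; apply: contra nS => /sS. Qed.

Definition ladd f g := laurent_of (finsupp f `|` finsupp g) (fun n => f n + g n).
Definition lopp f := laurent_of (finsupp f) (fun n => - f n).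
Definition lzero := laurent_of fset0 (fun=> 0).
Definition lone := laurent_of [fset 0] (fun=> 1).
Definition lmul f g :=
  laurent_of [fset i + j | i in finsupp f, j in finsupp g]
    (fun n => \sum_(i <- finsupp f) f i * g (n - i)).

Lemma laddE f g n : ladd f g n = f n + g n.
Proof.
rewrite laurent_ofE in_fsetU; case: (finsuppP f n); case: (finsuppP g n) => //.
Qed.

Lemma loppE f n : lopp f n = - f n.
Proof. by rewrite laurent_ofE; case: (finsuppP f n); rewrite ?oppr0. Qed.

Lemma lzeroE n : lzero n = 0.
Proof. by rewrite laurent_ofE. Qed.

Lemma loneE n : lone n = (n == 0)%:R.
Proof. by rewrite laurent_ofE inE; case: eqP. Qed.

Lemma lmulE f g n : lmul f g n = \sum_(i <- finsupp f) f i * g (n - i).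
Proof.
rewrite laurent_ofE; case: ifPn => // nS; rewrite big_seq big1 // => i fi.
case: (finsuppP g (n - i)) => [_|gi]; first by rewrite mulr0.
case/negP: nS; apply/imfset2P; exists i => //; exists (n - i) => //.
by rewrite addrC subrK.
Qed.

Lemma sum_finsupp f S (c : 'rV[int]_d -> int) : finsupp f `<=` S ->
  \sum_(i <- finsupp f) f i * c i = \sum_(i <- S) f i * c i.
Proof.
by move=> sS; apply: big_fset_incl => // i _ /fsfun_dflt ->; rewrite mul0r.
Qed.

Lemma sum_shift g S (a : int) (c : 'rV[int]_d -> int) k :
  (forall j, j \in finsupp g -> k + j \in S) ->
  \sum_(n <- S) g (n - k) * c n = \sum_(j <- finsupp g) g j * c (k + j).
Proof.
move=> kS; transitivity (\sum_(n <- [fset k + j | j in finsupp g]) g (n - k) * c n).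
  apply/esym/big_fset_incl.
    by apply/fsubsetP => _ /imfsetP[j /= gj ->]; exact: kS.
  move=> n _ /imfsetP nS; rewrite [g _]fsfun_dflt ?mul0r //.
  by apply: contra_notN nS => gn; exists (n - k) => //=; rewrite addrC subrK.
rewrite big_imfset /=; last by move=> i j _ _; apply: addrI.
by apply: eq_bigr => j _; rewrite (addrC k) addrK.
Qed.

Lemma sum_lmul f g (c : 'rV[int]_d -> int) :
  \sum_(n <- finsupp (lmul f g)) lmul f g n * c n =
  \sum_(i <- finsupp f) \sum_(j <- finsupp g) f i * g j * c (i + j).
Proof.
pose S := [fset i + j | i in finsupp f, j in finsupp g].
rewrite (@sum_finsupp _ S); last first.
  apply/fsubsetP => n; rewrite mem_finsupp laurent_ofE.
  by case: ifPn => //; rewrite eqxx.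
under eq_bigr do rewrite lmulE mulr_suml.
rewrite exchange_big /= big_seq [RHS]big_seq; apply: eq_bigr => i fi.
under eq_bigr do rewrite -mulrA.
rewrite -mulr_sumr (sum_shift 0) ?mulr_sumr.
  by apply: eq_bigr => j _; rewrite mulrA.
by move=> j gj; apply/imfset2P; exists i => //; exists j.
Qed.

Lemma lmulC : commutative lmul.
Proof.
move=> f g; apply/laurentP => n; rewrite !lmulE.
pose S := finsupp f `|` [fset n - j | j in finsupp g].
rewrite (@sum_finsupp _ S) ?fsubsetUl //.
transitivity (\sum_(i <- [fset n - j | j in finsupp g]) f i * g (n - i)).
  apply/esym/big_fset_incl; first exact: fsubsetUr.
  move=> i _ /imfsetP iS; rewrite [g _]fsfun_dflt ?mulr0 //.
  by apply: contra_notN iS => gi; exists (n - i) => //=; rewrite opprB addrC subrK.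
rewrite big_imfset /=; last by move=> i j _ _ /addrI/oppr_inj.
by apply: eq_bigr => j _; rewrite opprB [X in g X]addrC subrK mulrC.
Qed.

Lemma lmulA : associative lmul.
Proof.
move=> f g h; apply/laurentP => n; rewrite [RHS]lmulE.
rewrite (sum_lmul f g (fun k => h (n - k))) lmulE; apply: eq_bigr => i _.
by rewrite lmulE mulr_sumr; apply: eq_bigr => j _; rewrite mulrA opprD addrA.
Qed.

Lemma lmul1 : left_id lone lmul.
Proof.
move=> f; apply/laurentP => n; rewrite lmulE (@sum_finsupp _ [fset 0]).
  by rewrite big_seq_fset1 loneE eqxx mul1r subr0.
by apply/fsubsetP => k; rewrite mem_finsupp loneE inE; case: (k == 0).
Qed.

Lemma lmulDl : left_distributive lmul ladd.
Proof.
move=> f g h; apply/laurentP => n; rewrite laddE !lmulE.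
pose S := finsupp f `|` finsupp g.
rewrite !(@sum_finsupp _ S) ?fsubsetUl ?fsubsetUr //.
  by rewrite -big_split /=; apply: eq_bigr => i _; rewrite laddE mulrDl.
apply/fsubsetP => k; rewrite mem_finsupp laurent_ofE.
by case: ifPn => //; rewrite eqxx.
Qed.

Lemma laddA : associative ladd.
Proof. by move=> f g h; apply/laurentP => n; rewrite !laddE addrA. Qed.

Lemma laddC : commutative ladd.
Proof. by move=> f g; apply/laurentP => n; rewrite !laddE addrC. Qed.

Lemma ladd0 : left_id lzero ladd.
Proof. by move=> f; apply/laurentP => n; rewrite laddE lzeroE add0r. Qed.

Lemma laddN : left_inverse lzero lopp ladd.
Proof. by move=> f; apply/laurentP => n; rewrite laddE loppE lzeroE addNr. Qed.

Lemma lone_neq0 : lone != lzero.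
Proof.
by apply/eqP => /laurentP/(_ 0); rewrite loneE lzeroE eqxx => /eqP; rewrite oner_eq0.
Qed.

End LaurentRing.

HB.instance Definition _ d :=
  GRing.isZmodule.Build (laurent d) laddA laddC ladd0 laddN.
HB.instance Definition _ d :=
  GRing.Zmodule_isComNzRing.Build (laurent d) lmulA lmulC lmul1 lmulDl lone_neq0.

Section LaurentDefs.
Context {d : nat}.
Implicit Types (f g : laurent d) (n : 'rV[int]_d).

Definition lmonom n : laurent d := laurent_of [fset n]%fset (fun=> 1).

Definition ldivides f g := exists h : laurent d, g = f * h.

Definition lunit f := exists g : laurent d, f * g = 1.

Definition primitive f :=
  f != 0 /\ \big[gcdz/0]_(n <- finsupp f) f n = 1.

Definition irreducible f :=
  ~ exists g h : laurent d, [/\ f = g * h, ~ lunit g & ~ lunit h].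

(* g(z^m) *)
Definition dilate (m : nat) g : laurent d :=
  \sum_(n <- finsupp g) lmonom (n *+ m) *~ g n.

Definition good_C1 (m : nat) f :=
  forall g, (forall n, g n \in [:: -2; -1; 0; 1; 2]) ->
    dilate m g != 0 -> ~ ldivides f (dilate m g).

Definition good_C2 (m : nat) f :=
  forall k n n' : 'rV[int]_d,
    (forall j, 0 <= k 0 j < m%:Z) -> k != 0 -> n != n' ->
  forall g, g != 0 -> (forall l, g l \in [:: -1; 0; 1]) ->
    ~ ldivides f (lmonom (n *+ m + k) - lmonom (n' *+ m + k) + dilate m g).

Definition good (m : nat) f :=
  [/\ primitive f, irreducible f, good_C1 m f & good_C2 m f].

End LaurentDefs.

Section LebesgueRd.
Context {R : realType}.
Local Notation RT := (measurableTypeR R).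
Local Open Scope ereal_scope.

Section cons.
Context {n : nat} (mu : {sigma_finite_measure set (n.-tuple RT) -> \bar R}).

Let tuple_cons (p : RT * n.-tuple RT) : n.+1.-tuple RT := [tuple of p.1 :: p.2].

Let measurable_tuple_cons : measurable_fun [set: RT * n.-tuple RT] tuple_cons.
Proof. exact: measurable_cons. Qed.

Definition lebesgue_cons : set (n.+1.-tuple RT) -> \bar R :=
  pushforward (@lebesgue_measure R \x mu) tuple_cons.

HB.instance Definition _ := Measure.copy lebesgue_cons
  (measure_function_pushforward__canonical__measure_function_Measure
    (@lebesgue_measure R \x mu) measurable_tuple_cons).

Let lebesgue_cons_sigma_finite : sigma_finite [set: n.+1.-tuple RT] lebesgue_cons.
Proof.
have /sigma_finiteP[F [TF ndF Foo]] := sigma_finiteT (@lebesgue_measure R).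
have /sigma_finiteP[G [TG ndG Goo]] := sigma_finiteT mu.
pose uncons (t : n.+1.-tuple RT) : RT * n.-tuple RT := (thead t, [tuple of behead t]).
have unconsK t : tuple_cons (uncons t) = t.
  by rewrite /tuple_cons /uncons /= -tuple_eta.
have consK p : uncons (tuple_cons p) = p.
  case: p => x t; rewrite /uncons /tuple_cons /= theadE; congr (_, _); exact/val_inj.
have muncons : measurable_fun [set: n.+1.-tuple RT] uncons.
  apply/measurable_fun_pair.
    exact: measurable_tnth.
  exact: measurable_behead.
exists (fun i => uncons @^-1` (F i `*` G i)).
  apply/seteqP; split=> // t _.
  have [i _ Fi] : (\bigcup_i F i) (uncons t).1 by rewrite -TF.
  have [j _ Gj] : (\bigcup_i G i) (uncons t).2 by rewrite -TG.
  exists (maxn i j) => //; split.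
    by move: (Fi); apply/subsetPset/ndF/leq_maxl.
  by move: (Gj); apply/subsetPset/ndG/leq_maxr.
move=> i; have [mF Fi] := Foo i; have [mG Gi] := Goo i; split.
  by rewrite -[X in measurable X]setTI; apply: muncons => //; exact: measurableX.
rewrite /lebesgue_cons /pushforward -comp_preimage.
rewrite (_ : uncons \o _ = id); last exact/funext.
by rewrite preimage_id product_measure1E// lte_mul_pinfty// ge0_fin_numE.
Qed.

HB.instance Definition _ :=
  Measure_isSigmaFinite.Build _ _ _ lebesgue_cons lebesgue_cons_sigma_finite.

End cons.

(* d-dimensional Lebesgue measure; the library has the product sigma-algebra on
   tuples but no n-fold product measure. *)
Fixpoint lebesgue_tuple (n : nat) :
    {sigma_finite_measure set (n.-tuple RT) -> \bar R} :=
  if n is n'.+1 then lebesgue_cons (lebesgue_tuple n') else \d_[tuple].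

End LebesgueRd.

Section MahlerMeasure.
Variable R : realType.

Definition leval d (f : laurent d) (z : 'I_d -> R[i]) : R[i] :=
  \sum_(n <- finsupp f) (\prod_(j < d) z j ^ n 0 j) *~ f n.

Definition cexp2pi (t : R) : R[i] := (cos (2 * pi * t) +i* sin (2 * pi * t))%C.

Definition unit_cube d : set (d.-tuple (measurableTypeR R)) :=
  [set t | forall j, (tnth t j : R) \in `[0, 1]].

(* lne 0 = -oo *)
Definition mahler d (f : laurent d) : \bar R :=
  (\int[lebesgue_tuple d]_(t in @unit_cube d)
     lne (ComplexField.Normc.normc (leval f (fun j => cexp2pi (tnth t j))))%:E)%E.

End MahlerMeasure.

Section Circle.
Variable R : realType.

Let int_zmod := GRing.ZmodClosed.clone R (@Num.int_num_subdef R) _.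

(* R/Z with the quotient topology *)
Definition circle : Type := quotient_topology (Quotient.quot int_zmod).

HB.instance Definition _ := Topological.on circle.
HB.instance Definition _ := Quotient.on circle.
HB.instance Definition _ := GRing.isZmodule.Build circle
  (@Quotient.addqA _ int_zmod) (@Quotient.addqC _ int_zmod)
  (@Quotient.add0q _ int_zmod) (@Quotient.addNq _ int_zmod).

Local Open Scope quotient_scope.
Definition circle_pi (t : R) : circle := \pi_circle t.

Lemma circle_pi_continuous : continuous circle_pi.
Proof. exact: pi_continuous. Qed.

Lemma circle_piD : {morph circle_pi : x y / x + y}.
Proof. exact: Quotient.pi_add. Qed.

Lemma circle_piN : {morph circle_pi : x / - x}.
Proof. exact: Quotient.pi_opp. Qed.

Lemma circle_pi0 : circle_pi 0 = 0.
Proof. by apply: (addrI (circle_pi 0)); rewrite -circle_piD !addr0. Qed.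

Lemma circle_pi_eq x y : (circle_pi x = circle_pi y) <-> x - y \is a Num.int.
Proof.
have E := Quotient.idealrBE int_zmod x y.
split=> [xy|xy].
  by apply: etrans E _; apply/eqP; exact: xy.
by have /eqP := etrans (esym E) xy.
Qed.

Lemma circle_pi_surj (a : circle) : exists t, a = circle_pi t.
Proof. by exists (repr a); rewrite /circle_pi reprK. Qed.

Lemma circle_openP (U : set circle) : open U <-> open (circle_pi @^-1` U).
Proof. by []. Qed.

Lemma circle_pi_nbhs (t : R) (A : set R) : nbhs t A -> nbhs (circle_pi t) (circle_pi @` A).
Proof.
rewrite {1}nbhsE => -[B [oB Bt] BA].
rewrite nbhsE; exists (circle_pi @` B); last exact: image_subset.
split; last by exists t.
apply/circle_openP.
have -> : circle_pi @^-1` (circle_pi @` B) =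
    \bigcup_(k in [set: int]) ((fun x => x + k%:~R) @^-1` B).
  apply/seteqP; split=> [x [y By /circle_pi_eq/intrP[k yx]]|x [k _ Bxk]].
    by exists k => //=; rewrite -yx addrC subrK.
  exists (x + k%:~R) => //; apply/circle_pi_eq; rewrite addrAC subrr add0r.
  exact: Num.Theory.intr_int.
apply: bigcup_open => k _; apply: open_comp => // x _.
by apply: continuousD => //; exact: cvg_cst.
Qed.

Lemma circleD_continuous : continuous (fun p : circle * circle => p.1 + p.2).
Proof.
move=> [a b] U /=; have [s ->] := circle_pi_surj a; have [t ->] := circle_pi_surj b.
rewrite -circle_piD => /circle_pi_continuous /(@add_continuous R (s, t)) [[A B] /= [As Bt] AB].
exists (circle_pi @` A, circle_pi @` B).
  by split; exact: circle_pi_nbhs.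
move=> [_ _] /= [[x Ax <-] [y By <-]]; rewrite -circle_piD.
exact: (AB (x, y)).
Qed.

Lemma circleN_continuous : continuous (fun a : circle => - a).
Proof.
move=> a U; have [s ->] := circle_pi_surj a.
rewrite -circle_piN => /circle_pi_continuous /(@opp_continuous R s).
move=> /circle_pi_nbhs; apply: filterS => _ [x Ux <-] /=.
by rewrite -circle_piN.
Qed.

Lemma circle_compact : compact [set: circle].
Proof.
have -> : [set: circle] = circle_pi @` `[0, 1].
  apply/seteqP; split=> // a _; have [t ->] := circle_pi_surj a.
  exists (t - (Num.floor t)%:~R).
    rewrite /= in_itv /= subr_ge0 Num.Theory.floor_le lerBlDl.
    by rewrite -intrD1 ltW // Num.Theory.floorD1_gt.
  apply/circle_pi_eq; rewrite addrAC subrr add0r rpredN.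
  exact: Num.Theory.intr_int.
apply: continuous_compact; last exact: segment_compact.
exact/continuous_subspaceT/circle_pi_continuous.
Qed.

Lemma circle_closed0 : closed [set (0 : circle)].
Proof.
rewrite -openC; apply/circle_openP.
have -> : circle_pi @^-1` (~` [set 0]) =
    \bigcup_(k in [set: int]) `]k%:~R, (k + 1)%:~R[%classic.
  apply/seteqP; split=> [x x0|x [k _ /= xk] x0].
    exists (Num.floor x) => //=; rewrite in_itv /= Num.Theory.floorD1_gt andbT.
    rewrite lt_neqAle Num.Theory.floor_le andbT -Num.Theory.intrEfloor.
    apply/negP => xZ; apply: x0; rewrite /= -circle_pi0.
    by apply/circle_pi_eq; rewrite subr0.
  have /Num.Theory.intrP[n xn] : x \is a Num.int.
    by rewrite -[x]subr0; apply/circle_pi_eq; rewrite circle_pi0.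
  move: xk; rewrite in_itv /= xn !ltr_int => /andP[kn].
  by rewrite ltzD1 leNgt kn.
by apply: bigcup_open => k _; exact: interval_open.
Qed.

Lemma circle_sum_continuous (T : topologicalType) (I : Type) (r : seq I)
    (F : I -> T -> circle) :
  (forall i, continuous (F i)) -> continuous (fun x => \sum_(i <- r) F i x).
Proof.
move=> cF; elim: r => [|i r IH].
  by under eq_fun do rewrite big_nil; exact: cst_continuous.
under eq_fun do rewrite big_cons.
move=> x.
apply: (@cvg_comp _ _ _ (fun y => (F i y, \sum_(j <- r) F j y))
  (fun p => p.1 + p.2) _ (nbhs (F i x, \sum_(j <- r) F j x))).
  exact: (cvg_pair (cF i x) (IH x)).
exact: (@circleD_continuous (F i x, \sum_(j <- r) F j x)).
Qed.

Lemma circleMz_continuous (m : int) : continuous (fun a : circle => a *~ m).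
Proof.
have cn n : continuous (fun a : circle => a *+ n).
  rewrite (_ : (fun a => _) = fun a : circle => \sum_(i <- iota 0 n) a).
    by apply: circle_sum_continuous => _ a; exact: cvg_id.
  apply/funext => a.
  by rewrite big_const_seq count_predT size_iota iter_addr_0.
case: m => n; first exact: cn.
move=> a; apply: (continuous_comp (cn n.+1 a)); exact: circleN_continuous.
Qed.

End Circle.

Lemma compact_set_type (T : topologicalType) (A : set T) :
  compact A -> compact [set: A].
Proof.
move=> cA F FF _; pose G : set_system T := (fun u : A => val u) @ F.
have GA : G A.
  rewrite /G /fmap /= (_ : _ @^-1` _ = setT); first exact: filterT.
  by apply/seteqP; split=> // u _; exact: set_valP.
have [x [Ax cx]] := cA G _ GA.
exists (SigSub (mem_set Ax)); split=> // U V FU.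
rewrite nbhsE => -[W [[W' oW' <-] /= W'x] WV].
have [||y [[u Uu <-] W'u]] := cx ((fun u : set_type A => val u) @` U) W'.
- rewrite /G /fmap /=; apply: (@filterS _ F _ U) FU => u Uu.
  by exists u.
- exact: open_nbhs_nbhs.
by exists u; split => //; exact: WV.
Qed.

Record zd_system (d : nat) := ZdSystem {
  space :> topologicalType;
  space_compact : compact [set: space];
  act : 'rV[int]_d -> space -> space;
  act_continuous : forall n, continuous (act n);
  act0 : forall x, act 0 x = x;
  actD : forall m n x, act (m + n) x = act m (act n x)
}.

Section PrincipalAction.
Variables (R : realType) (d : nat) (f : laurent d).
Local Notation ambient := {ptws 'rV[int]_d -> circle R}.

Definition principal_set : set ambient :=
  [set x | forall n, \sum_(m <- finsupp f) x (n + m) *~ f m = 0].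

Lemma principal_set_closed : closed principal_set.
Proof.
have -> : principal_set = \bigcap_(n in [set: 'rV[int]_d])
    ((fun x : ambient => \sum_(m <- finsupp f) x (n + m) *~ f m) @^-1` [set 0]).
  by apply/seteqP; split=> [x Xx n _|x Xx n]; [exact: Xx|exact: (Xx n I)].
apply: closed_bigI => n _; apply: preimage_closed; last exact: circle_closed0.
move=> x _; apply: circle_sum_continuous => m {}x.
exact: (@cvg_comp _ _ _ (@proj _ (fun=> circle R) (n + m))
  (fun a => a *~ f m) _ _ _ (@proj_continuous _ (fun=> circle R) (n + m) x)
  (@circleMz_continuous _ _ _)).
Qed.

Lemma principal_compact : compact [set: principal_set].
Proof.
have cT := @tychonoff 'rV[int]_d (fun=> circle R) (fun=> setT)
  (fun=> @circle_compact R).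
by apply: compact_set_type; exact: (subclosed_compact principal_set_closed cT).
Qed.

Definition zd_shift (m : 'rV[int]_d) (x : ambient) : ambient :=
  fun n => x (n + m).

Lemma zd_shift_continuous m : continuous (zd_shift m).
Proof.
move=> x; have FF : Filter (zd_shift m @ x).
  by apply: fmap_filter; exact: nbhs_filter.
apply/cvg_sup => n.
exact: (@continuous_comp_initial _ _ _ (@proj _ (fun=> circle R) n) (zd_shift m)
  (@proj_continuous _ (fun=> circle R) (n + m)) x).
Qed.

Lemma zd_shift_principal m x : principal_set x -> principal_set (zd_shift m x).
Proof.
move=> Xx n; rewrite -[RHS](Xx (n + m)).
by apply: eq_bigr => k _; rewrite /zd_shift addrAC.
Qed.

Definition principal_act (m : 'rV[int]_d) (x : principal_set) : principal_set :=
  SigSub (mem_set (zd_shift_principal m (set_valP x))).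

Lemma principal_act_continuous m : continuous (principal_act m).
Proof.
apply: (@continuous_comp_initial principal_set principal_set ambient
  (fun u : principal_set => val u)).
move=> x; apply: (@cvg_comp _ _ _ (fun u : principal_set => val u) (zd_shift m)
  _ (nbhs (val x : ambient))).
  exact: (@initial_continuous principal_set ambient (fun u => val u)).
exact: zd_shift_continuous.
Qed.

Lemma principal_act0 x : principal_act 0 x = x.
Proof. by apply/val_inj/funext => n /=; rewrite /zd_shift addr0. Qed.

Lemma principal_actD m n x :
  principal_act (m + n) x = principal_act m (principal_act n x).
Proof. by apply/val_inj/funext => k /=; rewrite /zd_shift addrA. Qed.

Definition principal_system : zd_system d :=
  ZdSystem principal_compact principal_act_continuous
    principal_act0 principal_actD.

End PrincipalAction.

Section BohrChaoticity.
Variables (R : realType) (d : nat).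
Local Notation normc := ComplexField.Normc.normc.

(* A point n : 'rV['I_N]_d of the box [0, N-1]^d, seen in N^d and in Z^d. *)
Definition box_nat N (n : 'rV['I_N]_d) : 'rV[nat]_d :=
  map_mx (fun i : 'I_N => nat_of_ord i) n.
Definition box_int N (n : 'rV['I_N]_d) : 'rV[int]_d :=
  map_mx (fun i : 'I_N => Posz i) n.

Definition nontrivial_weight (w : 'rV[nat]_d -> R[i]) :=
  (exists M : R, forall n, normc (w n) <= M) /\
  (0 < limn_esup (fun N : nat =>
     (N%:R ^- d * \sum_(n : 'rV['I_N]_d) normc (w (box_nat n)))%:E))%E.

Definition bohr_chaotic (X : zd_system d) :=
  forall w : 'rV[nat]_d -> R[i], nontrivial_weight w ->
  exists (h : X -> R[i]^o) (x : X), continuous h /\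
  (0 < limn_esup (fun N : nat =>
     (N%:R ^- d * normc (\sum_(n : 'rV['I_N]_d)
        w (box_nat n) * (h (act (box_int n) x) : R[i])))%:E))%E.

End BohrChaoticity.

(* Main.v *)
From HB Require Import structures.
Require Import Defs.
From mathcomp Require Import all_boot all_order all_algebra finmap.
From mathcomp Require Import all_classical all_reals all_analysis.
From mathcomp Require Import complex ring.
Set Implicit Arguments.
Unset Strict Implicit.
Unset Printing Implicit Defensive.
Import Order.TTheory GRing.Theory Num.Theory.
Import numFieldNormedType.Exports.
Local Open Scope classical_set_scope.
Local Open Scope ring_scope.

(* Let [chi_n] be the character [x |-> e(x_n)] of [X_f], [w] a nontrivial weight,
   and [k] a class of [Z^d / m Z^d] that carries a positive proportion of [|w|]
   along infinitely many boxes.  By (C1) the characters [chi_n], [n = k mod m],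
   are dissociate, so the Riesz product [prod (1 + 2 Re (a_n chi_n))] with
   [2 a_n] the phase of [w_n] is a probability density under which
   [chi_n - conj a_n] is an orthogonal family whose means [conj a_n] are aligned
   with the weight; by (C2) the characters in each other class are orthogonal and
   the corresponding weighted sums are negligible in mean square.  Only finitely
   many Fourier coefficients matter at a time, so Haar measure can be replaced by
   uniform averages over suitable finite sets of points.  This gives, for every
   finite set of sufficiently sparse box sizes, a point of [X_f] at which all the
   averages are bounded below; a cluster point of these works for infinitely
   many sizes. *)

(** * Extending homomorphisms of abelian groups into the circle *)

Lemma int_subgroup_principal (P : int -> Prop) :
  P 0 -> (forall i j, P i -> P j -> P (i - j)) ->
  exists n : nat, P n /\ forall j, P j -> exists q, j = q * n%:Z.
Proof.
move=> P0 PB; have PN i : P i -> P (- i) by rewrite -sub0r; exact: PB.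
have PD i j : P i -> P j -> P (i + j).
  by move=> Pi Pj; rewrite -[j]opprK; apply: PB => //; exact: PN.
have PM i q : P i -> P (q * i).
  move=> Pi; have Pn n : P (n%:Z * i).
    by elim: n => [|n IH]; rewrite ?mul0r// intS mulrDl mul1r; exact: PD.
  by case: q => n //; rewrite NegzE mulNr; exact: PN.
have [ex|nex] := pselect (exists n : nat, (0 < n)%N && `[< P n >]); last first.
  exists 0%N; split=> // j Pj; exists 0; rewrite mul0r; apply/eqP/contraT => j0.
  exfalso; apply: nex; exists `|j|%N; rewrite absz_gt0 j0 /=; apply/asboolP.
  by rewrite abszE; case: (ger0P j) => // _; exact: PN.
case: (ex_minnP ex) => n /andP[n0 /asboolP Pn] nmin; exists n; split=> // j Pj.
have n0' : n%:Z != 0 by rewrite eqz_nat -lt0n.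
have := modz_ge0 j n0'; have := ltz_pmod j (_ : 0 < n%:Z).
have := divz_eq j n; set q := (j %/ n)%Z; set r := (j %% n)%Z => jE.
move=> /(_ n0) rn r0; exists q.
have Pr : P r.
  by have -> : r = j - q * n by [rewrite jE addrAC subrr add0r]; apply: PB => //; exact: PM.
have [r00|rn0] := eqVneq r 0; first by rewrite jE r00 addr0.
have rE : r = `|r|%N by rewrite gez0_abs.
have := nmin `|r|%N; rewrite absz_gt0 rn0 /= -rE.
by move=> /(_ (asboolT Pr)); rewrite -lez_nat -rE leNgt rn.
Qed.

Lemma pair_mulrz (U V : zmodType) (u : U) (v : V) j :
  (u, v) *~ j = (u *~ j, v *~ j) :> U * V.
Proof.
have En n : (u, v) *+ n = (u *+ n, v *+ n) :> U * V.
  by elim: n => [|n IH] //; rewrite !mulrS IH.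
by case: j => n; rewrite /intmul En.
Qed.

Section CircleExtension.
Variable R : realType.
Local Notation T := (circle R).

Lemma circle_pi_mulrn (t : R) n : circle_pi (t *+ n) = circle_pi t *+ n.
Proof. by elim: n => [|n IH]; rewrite ?circle_pi0// !mulrS circle_piD IH. Qed.

Lemma circle_divisible (a : T) n : (0 < n)%N -> exists b, b *+ n = a.
Proof.
move=> n0; have [t ->] := circle_pi_surj a.
exists (circle_pi (t / n%:R)); rewrite -circle_pi_mulrn -mulrnAr.
by rewrite -(@mulr_natr R n%:R^-1) mulVf ?mulr1// pnatr_eq0 -lt0n.
Qed.

(** The graph of a homomorphism from a subgroup of [V] to the circle. With graphs, chains are joined
    by plain unions. *)
Definition partial_hom (V : zmodType) (G : set (V * T)) :=
  [/\ G 0, forall p q, G p -> G q -> G (p - q) & forall y, G (0, y) -> y = 0].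

Lemma partial_homMz (V : zmodType) (G : set (V * T)) p j :
  partial_hom G -> G p -> G (p *~ j).
Proof.
move=> [G0 GB _] Gp; have GN q : G q -> G (- q) by rewrite -sub0r; exact: GB.
have Gn n : G (p *+ n).
  elim: n => // n IH; rewrite mulrS -[p *+ n]opprK; apply: GB => //; exact: GN.
by case: j => n; [exact: Gn|apply: GN; exact: (Gn n.+1)].
Qed.

(** The integers [j] with [v *~ j] in the domain are the multiples of some [n]. The circle being
    divisible, some [t] has [t *+ n] equal to the prescribed value at [v *~ n], and [v] may be sent
    to [t]. *)
Lemma partial_hom_extend1 (V : zmodType) (G : set (V * T)) (v : V) :
  partial_hom G -> exists t : T, exists2 H, partial_hom H & G `<=` H /\ H (v, t).
Proof.
move=> hG; have [G0 GB Gf] := hG.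
pose P j := exists y, G (v *~ j, y).
have [||n [[y Gy] nP]] := @int_subgroup_principal P.
- by exists 0; rewrite mulr0z.
- by move=> i j [y Gy] [z Gz]; exists (y - z); rewrite mulrzBr; exact: (GB _ _ Gy Gz).
have [t tn] : exists t, t *+ n = y.
  have [n0|n0] := posnP n; last exact: circle_divisible.
  by exists 0; rewrite mul0rn; apply/esym/Gf; move: Gy; rewrite n0 mulr0z.
have key j z : G (v *~ j, z) -> z = t *~ j.
  move=> Gz; have [|q jE] := nP j; first by exists z.
  have /Gf/eqP : G (0, z - y *~ q).
    have := GB _ _ Gz (partial_homMz q hG Gy).
    by rewrite pair_mulrz; congr (G (_, _)); rewrite /= jE mulrC mulrzA subrr.
  rewrite subr_eq0 => /eqP ->; rewrite -tn jE mulrC mulrzA.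
  by [].
exists t; exists [set p | exists q j, G q /\ p = q + (v, t) *~ j]; last first.
  split=> [p Gp|]; first by exists p, 0; rewrite mulr0z addr0.
  by exists 0, 1; rewrite mulr1z add0r.
split.
- by exists 0, 0; rewrite mulr0z addr0.
- move=> _ _ [p [i [Gp ->]]] [q [j [Gq ->]]]; exists (p - q), (i - j).
  by split; [exact: GB|rewrite mulrzBr opprD addrACA].
- move=> z [[a b] [j [Gab]]].
  rewrite pair_mulrz => -[/esym/eqP]; rewrite addr_eq0 => /eqP aE ->.
  have : G (v *~ (- j), b) by rewrite mulrNz -aE.
  by move=> /key ->; rewrite mulrNz addNr.
Qed.

Lemma partial_hom_extend (V : zmodType) (G : set (V * T)) : partial_hom G ->
  exists2 phi : V -> T, (forall a b, phi (a - b) = phi a - phi b) &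
    forall p, G p -> phi p.1 = p.2.
Proof.
move=> hG; have [G0 GB Gf] := hG.
(* Zorn's lemma is applied to what is added to [G], so that the empty chain, with empty union,
   causes no exception. *)
pose P : set (set (V * T)) := [set H | partial_hom (G `|` H)].
have [F FP Ftot|A [PA Amax]] := @Zorn_bigcup _ P.
  split.
  - by left.
  - have mono X p : F X -> (G `|` X) p -> (G `|` \bigcup_(X in F) X) p.
      by move=> FX [Gp|Xp]; [left|right; exists X].
    move=> p q [Gp|[X FX Xp]] [Gq|[Y FY Yq]].
    + by left; exact: GB.
    + by apply: (mono Y) => //; have [_ B _] := FP Y FY; apply: B; [left|right].
    + by apply: (mono X) => //; have [_ B _] := FP X FX; apply: B; [right|left].
    + have [XY|YX] := Ftot X Y FX FY.
        apply: (mono Y) => //; have [_ B _] := FP Y FY.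
        by apply: B; right => //; exact: XY.
      apply: (mono X) => //; have [_ B _] := FP X FX.
      by apply: B; right => //; exact: YX.
  - move=> y [/Gf//|[X FX Xy]]; have [_ _ Xf] := FP X FX.
    by apply: Xf; right.
pose M := G `|` A; have hM : partial_hom M := PA.
have tot v : exists y, M (v, y).
  have [t [H hH [MH Hvt]]] := partial_hom_extend1 v hM.
  exists t; apply: contrapT => nM; apply: (Amax H).
    split; first by move=> p Ap; apply: MH; right.
    by move=> HA; apply: nM; right; exact: HA.
  rewrite /P /= (_ : G `|` H = H)//; apply/setUidPr => p Gp; apply: MH; by left.
have [_ MB Mf] := hM.
have fn v y z : M (v, y) -> M (v, z) -> y = z.
  move=> My Mz; apply/eqP; rewrite -subr_eq0; apply/eqP/Mf.
  by have := MB _ _ My Mz; congr (M (_, _)); rewrite /= ?subrr.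
pose phi v := projT1 (cid (tot v)).
have phiM v : M (v, phi v) by exact: (projT2 (cid (tot v))).
exists phi => [a b|[v y] Gp].
  by apply: (fn (a - b)) => //; exact: (MB _ _ (phiM a) (phiM b)).
by apply: (fn v) => //; left.
Qed.

End CircleExtension.

(** * Laurent polynomials paired with points of the torus *)

Section LaurentPairing.
Variables (R : realType) (d : nat).
Local Notation T := (circle R).
Local Notation Zd := 'rV[int]_d.
Implicit Types (f g h u v : laurent d) (n k : Zd) (x y : Zd -> T).

Definition lcoef n u : int := u n.
Arguments lcoef : simpl never.

Lemma lcoef_is_zmod_morphism n : zmod_morphism (lcoef n).
Proof. by move=> u v; rewrite /lcoef laddE loppE. Qed.
HB.instance Definition _ n :=
  GRing.isZmodMorphism.Build (laurent d) int (lcoef n) (lcoef_is_zmod_morphism n).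

Lemma lcoef_monom n k : lcoef k (lmonom n) = (k == n)%:R.
Proof. by rewrite /lcoef /lmonom laurent_ofE inE; case: eqP. Qed.

Lemma lmonom0 : lmonom 0 = 1 :> laurent d.
Proof. by apply/laurentP => k; rewrite -[LHS]/(lcoef k _) lcoef_monom loneE. Qed.

Lemma laurent_decomp u (S : {fset Zd}) : (finsupp u `<=` S)%fset ->
  u = \sum_(n <- S) lmonom n *~ u n.
Proof.
move=> /fsubsetP uS; apply/laurentP => k; rewrite -[LHS]/(lcoef k u) -[RHS]/(lcoef k _) raddf_sum /=.
under eq_bigr do rewrite raddfMz /= lcoef_monom.
have [kS|kS] := boolP (k \in S).
  rewrite (big_fsetD1 k)//= eqxx intz big_seq big1 ?addr0// => n.
  by rewrite !inE eq_sym => /andP[/negPf -> _]; rewrite mul0rz.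
rewrite /lcoef fsfun_dflt ?(contra (uS k))// big_seq big1// => n nS.
by case: eqP => [kn|_]; [rewrite kn nS in kS|rewrite mul0rz].
Qed.

Lemma lmonomD n k : lmonom (n + k) = lmonom n * lmonom k :> laurent d.
Proof.
apply/laurentP => j; rewrite lmulE (@sum_finsupp _ _ [fset n]%fset); last first.
  apply/fsubsetP => i; rewrite mem_finsupp -/(lcoef i _) lcoef_monom inE.
  by case: (i == n).
rewrite big_seq_fset1 -!/(lcoef _ _) !lcoef_monom eqxx mul1r.
by rewrite subr_eq addrC.
Qed.

(** The Pontryagin pairing of [laurent d] with the torus over [Zd]; the points of [principal_set f]
    are those annihilating the ideal generated by [f]. *)
Definition pairing x u : T := \sum_(n <- finsupp u) x n *~ u n.
Arguments pairing : simpl never.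

Lemma pairingE x u (S : {fset Zd}) : (finsupp u `<=` S)%fset ->
  pairing x u = \sum_(n <- S) x n *~ u n.
Proof.
by move=> uS; apply: big_fset_incl => // n _ /fsfun_dflt ->; rewrite mulr0z.
Qed.

Lemma pairing_is_zmod_morphism x : zmod_morphism (pairing x).
Proof.
move=> u v; pose S := (finsupp u `|` finsupp v `|` finsupp (u - v))%fset.
rewrite !(@pairingE _ _ S); last 3 first.
- exact: fsubset_trans (fsubsetUr _ _) (fsubsetUl _ _).
- exact: fsubset_trans (fsubsetUl _ _) (fsubsetUl _ _).
- exact: fsubsetUr.
rewrite -sumrB; apply: eq_bigr => n _.
by rewrite -mulrzBr -[(u - v) n]/(lcoef n (u - v)) raddfB.
Qed.
HB.instance Definition _ x :=
  GRing.isZmodMorphism.Build (laurent d) T (pairing x) (pairing_is_zmod_morphism x).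

Lemma pairing_monom x n : pairing x (lmonom n) = x n.
Proof.
rewrite (@pairingE _ _ [fset n]%fset).
  by rewrite big_seq_fset1 -/(lcoef n _) lcoef_monom eqxx mulr1z.
apply/fsubsetP => i; rewrite mem_finsupp -/(lcoef i _) lcoef_monom inE.
by case: (i == n).
Qed.

Lemma pairing_addMn x y j u :
  pairing (fun n => x n + y n *+ j) u = pairing x u + pairing y u *+ j.
Proof.
rewrite /pairing -sumrMnl -big_split /=; apply: eq_bigr => n _.
by rewrite mulrzDl; congr (_ + _); rewrite !pmulrn -!mulrzA mulrC.
Qed.

Lemma laurent_mul_monom f n : f * lmonom n = \sum_(k <- finsupp f) lmonom (n + k) *~ f k.
Proof.
rewrite {1}(laurent_decomp (fsubset_refl (finsupp f))) mulr_suml.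
by apply: eq_bigr => k _; rewrite mulrzAl -lmonomD addrC.
Qed.

Lemma principal_addMn f x y j : principal_set f x -> principal_set f y ->
  principal_set f (fun n => x n + y n *+ j).
Proof.
move=> fx fy n; under eq_bigr do rewrite mulrzDl.
rewrite big_split /= (fx n) add0r.
under eq_bigr do rewrite pmulrn mulrzAC -pmulrn.
by rewrite sumrMnl (fy n) mul0rn.
Qed.

Lemma principal0 f : principal_set f (fun=> 0 : T).
Proof. by move=> n; rewrite big1// => k _; rewrite mul0rz. Qed.

(** On the subgroup generated by [u] and the ideal of [f], killing the ideal and sending [u] to
    [1/p] is well defined if only multiples of [p] bring [u] into the ideal. This homomorphism
    extends to [laurent d], and its values on monomials form a point of [X_f]. *)
Lemma principal_separates f u : ~ ldivides f u ->
  exists x, principal_set f x /\ exists2 p, (1 < p)%N &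
    pairing x u = circle_pi (p%:R^-1 : R).
Proof.
move=> fu; pose P j := ldivides f (u *~ j).
have [||n [Pn nP]] := @int_subgroup_principal P.
- by exists 0; rewrite mulr0z mulr0.
- by move=> i j [a aE] [b bE]; exists (a - b); rewrite mulrzBr mulrBr aE bE.
(* [p] is the order of [u] modulo [f], or [2] if that order is infinite ([n = 0]); order one would
   mean that [f] divides [u]. *)
have [p p1 pP] : exists2 p, (1 < p)%N & forall j, P j -> exists q, j = q * p%:Z.
  case: n Pn nP => [|[|n]] Pn nP; [|by case: fu|by exists n.+2].
  by exists 2%N => // j /nP[q ->]; exists 0; rewrite mulr0 mul0r.
pose c : T := circle_pi (p%:R^-1).
have cp : c *+ p = 0.
  rewrite -circle_pi_mulrn -(@mulr_natr R p%:R^-1) mulVf ?pnatr_eq0 -?lt0n 1?ltnW//.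
  by rewrite -circle_pi0; apply/circle_pi_eq; rewrite subr0 rpred1.
pose G := [set q : laurent d * T | exists h j, q = (f * h + u *~ j, c *~ j)].
have [|phi phiB phiG] := @partial_hom_extend R _ G.
  split.
  - by exists 0, 0; rewrite mulr0 !mulr0z addr0.
  - move=> _ _ [h [i ->]] [k [j ->]]; exists (h - k), (i - j).
    by rewrite mulrBr !mulrzBr; congr (_, _); rewrite /= ?opprD 1?addrACA.
  - move=> y [h [j [/esym/eqP]]]; rewrite addrC addr_eq0 => /eqP hj ->.
    have [|q ->] := pP j; first by exists (- h); rewrite hj mulrN.
    by rewrite mulrC mulrzA -pmulrn cp mul0rz.
pose phi' : {additive laurent d -> T} :=
  HB.pack phi (GRing.isZmodMorphism.Build _ _ phi phiB).
have phif h : phi (f * h) = 0.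
  by apply: (phiG (_, 0)); exists h, 0; rewrite !mulr0z addr0.
have phiE g : phi g = pairing (phi \o @lmonom d) g.
  rewrite {1}(laurent_decomp (fsubset_refl (finsupp g))) -[LHS]/(phi' _) raddf_sum.
  by apply: eq_bigr => k _; rewrite raddfMz.
exists (phi \o @lmonom d); split.
  move=> k; rewrite -[RHS](phif (lmonom k)) laurent_mul_monom phiE raddf_sum.
  by apply: eq_bigr => m _; rewrite raddfMz /= pairing_monom.
exists p => //; rewrite -phiE.
by apply: (phiG (_, _)); exists 0, 1; rewrite mulr0 add0r !mulr1z.
Qed.

End LaurentPairing.

(** * Characters of the circle and of [X_f], and finite averages *)

Section Characters.
Variable R : realType.
Local Notation T := (circle R).
Local Notation C := R[i].

Lemma cexp2piD (s t : R) : cexp2pi (s + t) = cexp2pi s * cexp2pi t.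
Proof. by rewrite /cexp2pi mulrDr cosD sinD /GRing.mul /= [_ + sin _ * _]addrC. Qed.

Lemma cexp2pi0 : cexp2pi 0 = 1 :> C.
Proof. by rewrite /cexp2pi mulr0 cos0 sin0. Qed.

Lemma cexp2pi1 : cexp2pi 1 = 1 :> C.
Proof. by rewrite /cexp2pi mulr1 mulr_natl cos2pi sin2pi. Qed.

Lemma cexp2pi_mulrn (t : R) n : cexp2pi (t *+ n) = cexp2pi t ^+ n.
Proof. by elim: n => [|n IH]; rewrite ?cexp2pi0// mulrS cexp2piD IH exprS. Qed.

Lemma cexp2piN (t : R) : cexp2pi (- t) = (cexp2pi t)^*.
Proof. by rewrite /cexp2pi mulrN cosN sinN. Qed.

Lemma cexp2pi_int (t : R) : t \is a Num.int -> cexp2pi t = 1 :> C.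
Proof.
have H n : cexp2pi n%:R = 1 :> C by rewrite cexp2pi_mulrn cexp2pi1 expr1n.
move=> /intrP[[n|n] ->]; first exact: H.
by rewrite NegzE mulrNz cexp2piN H rmorph1.
Qed.

Definition cis (a : T) : C := cexp2pi (repr a).

Lemma cis_pi (t : R) : cis (circle_pi t) = cexp2pi t.
Proof.
rewrite /cis; set s := repr _; have /circle_pi_eq st : circle_pi s = circle_pi t.
  by rewrite /circle_pi /s reprK.
by rewrite -[s](subrK t) cexp2piD cexp2pi_int// mul1r.
Qed.

Lemma cisD a b : cis (a + b) = cis a * cis b.
Proof.
have [s ->] := circle_pi_surj a; have [t ->] := circle_pi_surj b.
by rewrite -circle_piD !cis_pi cexp2piD.
Qed.

Lemma cis0 : cis 0 = 1.
Proof. by rewrite -(circle_pi0 R) cis_pi cexp2pi0. Qed.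

Lemma cisN a : cis (- a) = (cis a)^*.
Proof.
by have [s ->] := circle_pi_surj a; rewrite -circle_piN !cis_pi cexp2piN.
Qed.

Lemma cis_mulrn a n : cis (a *+ n) = cis a ^+ n.
Proof. by elim: n => [|n IH]; rewrite ?cis0// mulrS cisD IH exprS. Qed.

Lemma cis_conjM a : cis a * (cis a)^* = 1.
Proof. by rewrite -cisN -cisD subrr cis0. Qed.

Lemma norm_cis a : `|cis a| = 1.
Proof.
by apply/eqP; rewrite -(@pexpr_eq1 _ _ 2)// normCK cis_conjM.
Qed.

(** By the double angle formula, cos(2 pi / p) = 1 would force sin(pi / p) = 0, although 0 < pi / p
    < pi. *)
Lemma cis_inv_neq1 p : (1 < p)%N -> cis (circle_pi (p%:R^-1 : R)) != 1.
Proof.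
move=> p1; rewrite cis_pi; apply/eqP => -[c1 _].
have p0 : (0 < p%:R :> R) by rewrite ltr0n ltnW.
have : 0 < sin (pi / p%:R : R).
  apply: sin_gt0_pi; rewrite divr_gt0 ?pi_gt0//=.
  by rewrite ltr_pdivrMr// ltr_pMr ?pi_gt0// ltr1n.
move: c1; rewrite -mulrA mulr_natl cosD -!expr2 cos2sin2 => h.
have : sin (pi / p%:R : R) ^+ 2 *+ 2 == 0.
  by move: h => /eqP; rewrite -addrA -[X in _ == X]addr0 (inj_eq (addrI _)) -opprD oppr_eq0.
by rewrite mulrn_eq0 /= sqrf_eq0 => /eqP ->; rewrite ltxx.
Qed.

(** A geometric sum over a nontrivial [p]-th root of unity. This factor makes a character sum vanish
    once the points are translated by the multiples [j y], [j < p], of a separating point [y]. *)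
Lemma cis_root_sum p : (1 < p)%N ->
  \sum_(j < p) cis (circle_pi (p%:R^-1 : R)) ^+ j = 0.
Proof.
move=> p1; set z := cis _.
have zp : z ^+ p = 1.
  rewrite -cis_mulrn -circle_pi_mulrn -(@mulr_natr R p%:R^-1) mulVf ?pnatr_eq0 -?lt0n 1?ltnW//.
  by rewrite cis_pi cexp2pi1.
have /esym/eqP : z ^+ p - 1 = (z - 1) * \sum_(j < p) z ^+ j by exact: subrX1.
by rewrite zp subrr mulf_eq0 subr_eq0 (negPf (cis_inv_neq1 p1)) => /eqP.
Qed.

Variable d : nat.
Local Notation Zd := 'rV[int]_d.
Implicit Types (f u v : laurent d) (n : Zd) (x y : Zd -> T).

Definition chi x u : C := cis (pairing x u).

Lemma chi0 x : chi x 0 = 1. Proof. by rewrite /chi raddf0 cis0. Qed.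

Lemma chiD x u v : chi x (u + v) = chi x u * chi x v.
Proof. by rewrite /chi raddfD cisD. Qed.

Lemma chiN x u : chi x (- u) = (chi x u)^*.
Proof. by rewrite /chi raddfN cisN. Qed.

Lemma chiB x u v : chi x (u - v) = chi x u * (chi x v)^*.
Proof. by rewrite chiD chiN. Qed.

(* A finite substitute for Haar measure on [X_f]: uniform averages over finite
   families of points kill any given finite set of nontrivial characters. *)
Lemma averaging_points f (U : seq (laurent d)) :
  (forall u, u \in U -> ~ ldivides f u) ->
  exists (I : finType) (x : I -> Zd -> T),
    [/\ (0 < #|I|)%N, forall i, principal_set f (x i) &
        forall u, u \in U -> \sum_i chi (x i) u = 0].
Proof.
elim: U => [_|u U IH nU].
  exists unit, (fun _ _ => 0); split=> //; first by rewrite card_unit.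
  by move=> _; exact: principal0.
have [|I [x [I0 xf xU]]] := IH; first by move=> v vU; apply: nU; rewrite inE vU orbT.
have [|y [yf [p p1 yu]]] := @principal_separates R d f u; first exact/nU/mem_head.
exists (I * 'I_p)%type, (fun (ij : I * 'I_p) n => x ij.1 n + y n *+ ij.2); split.
- by rewrite card_prod card_ord muln_gt0 I0 ltnW.
- by move=> ij; exact: principal_addMn.
- move=> v vU; transitivity ((\sum_i chi (x i) v) * \sum_(j < p) chi y v ^+ j).
    rewrite mulr_suml; under [RHS]eq_bigr do rewrite mulr_sumr.
    rewrite pair_big /=; apply: eq_bigr => -[i j] _ /=.
    by rewrite /chi pairing_addMn cisD cis_mulrn.
  move: vU; rewrite inE => /predU1P[->|/xU ->]; last by rewrite mul0r.
  by rewrite [chi y u]/chi yu cis_root_sum// mulr0.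
Qed.

End Characters.

(** * Residue classes modulo [m] and the two divisibility conditions *)

Section Goodness.
Variables (d m : nat).
Hypothesis m_gt0 : (0 < m)%N.
Local Notation Zd := 'rV[int]_d.
Implicit Types (f g u v : laurent d) (n k e : Zd) (s : seq Zd) (c : Zd -> int).

Definition cls n : Zd := map_mx (fun z : int => (z %% m)%Z) n.
Definition quo n : Zd := map_mx (fun z : int => (z %/ m)%Z) n.

Lemma quo_cls n : n = quo n *+ m + cls n.
Proof.
by apply/rowP => j; rewrite !mxE mulmxnE !mxE {1}(divz_eq (n 0 j) m) -mulrzz pmulrn.
Qed.

Lemma mulrn_rowI n k : n *+ m = k *+ m -> n = k.
Proof.
move=> /rowP nk; apply/rowP => j; have := nk j.
have m0 : m%:R != 0 :> int by rewrite pnatr_eq0 -lt0n.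
by rewrite !mulmxnE -[n 0 j *+ m]mulr_natr -[k 0 j *+ m]mulr_natr; exact: (mulIf m0).
Qed.

Lemma cls_subr n n' k : cls n = cls n' -> cls (n - k) = cls (n' - k).
Proof.
move=> /rowP nn'; apply/rowP => j; have := nn' j; rewrite !mxE => E.
by rewrite -modzDml E modzDml.
Qed.

Lemma cls_addr n n' k : cls n = cls n' -> cls (n + k) = cls (n' + k).
Proof. by rewrite -[k]opprK; exact: cls_subr. Qed.

Lemma cls_ge0_lt n j : 0 <= cls n 0 j < m%:Z.
Proof. by rewrite mxE modz_ge0 ?ltz_pmod// eqz_nat -lt0n. Qed.

(** With coefficients in {-1, 0, 1} these are the frequencies occurring when a Riesz product over
    [s] is expanded. *)
Definition comb s c : laurent d := \sum_(e <- s) lmonom e *~ c e.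

Lemma dilateE g (S : {fset Zd}) : (finsupp g `<=` S)%fset ->
  dilate m g = \sum_(n <- S) lmonom (n *+ m) *~ g n.
Proof.
by move=> gS; apply: big_fset_incl => // n _ /fsfun_dflt ->; rewrite mulr0z.
Qed.

Lemma dilate0 : dilate m 0 = 0 :> laurent d.
Proof.
rewrite (@dilateE 0 fset0) ?big_seq_fset0//; apply/fsubsetP => e.
by rewrite mem_finsupp -[_ e]/(lcoef e 0) raddf0 eqxx.
Qed.

Lemma dilate_coef g n : lcoef (n *+ m) (dilate m g) = g n.
Proof.
rewrite (dilateE (fsubsetU1 n _)) raddf_sum /=.
rewrite (big_fsetD1 n)/= ?fset1U1// raddfMz /= lcoef_monom eqxx intz big_seq.
rewrite big1 ?addr0// => k; rewrite !inE => /andP[kn _].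
rewrite raddfMz /= lcoef_monom; case: eqP => [/mulrn_rowI nk|_]; last exact: mul0rz.
by rewrite nk eqxx in kn.
Qed.

(** Exponents in a common class [k] have the form [n *+ m + k], so the combination is a monomial
    times some g(z^m), the shape to which (C1) and (C2) apply. *)
Lemma comb_dilate k s c : uniq s -> {in s, forall e, cls e = k} ->
  exists2 g : laurent d, (forall n, g n = if n *+ m + k \in s then c (n *+ m + k) else 0) &
    comb s c = lmonom k * dilate m g.
Proof.
move=> us sk; pose S := [fset n in map quo s]%fset.
have quoE e : e \in s -> quo e *+ m + k = e by move=> es; rewrite -(sk e es) -quo_cls.
have inS n : (n \in S) = (n *+ m + k \in s).
  rewrite !inE /=; apply/mapP/idP => [[e es ->]|ns]; first by rewrite quoE.
  by exists (n *+ m + k) => //; have := quoE _ ns => /addIr/mulrn_rowI.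
pose g := laurent_of S (fun n => c (n *+ m + k)).
have gE n : g n = if n *+ m + k \in s then c (n *+ m + k) else 0.
  by rewrite laurent_ofE inS.
exists g => //.
rewrite (@dilateE g S); last first.
  apply/fsubsetP => n; rewrite mem_finsupp laurent_ofE.
  by case: ifP => //; rewrite eqxx.
rewrite mulr_sumr (perm_big (map quo s)) /=; last first.
  apply: uniq_perm; rewrite ?fset_uniq//.
    by rewrite map_inj_in_uniq// => a b /quoE {2}<- /quoE {2}<- ->.
  by move=> n; rewrite !inE.
rewrite big_map /comb big_seq [RHS]big_seq; apply: eq_bigr => e es.
by rewrite gE quoE// es mulrzAr -lmonomD addrC quoE.
Qed.

Lemma ldivides_monom f k v : ldivides f (lmonom k * v) -> ldivides f v.
Proof.
move=> [h hE]; exists (lmonom (- k) * h).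
by rewrite mulrCA -hE mulrA -lmonomD addNr lmonom0 mul1r.
Qed.

(** Dissociateness of a class: the monomial factor is a unit, so (C1) forces g(z^m) = 0, and its
    coefficients are the [c e]. Values up to 2 are allowed because [c] will be a difference of two
    sign patterns. *)
Lemma good_C1_comb f k s c : good_C1 m f -> uniq s -> {in s, forall e, cls e = k} ->
  (forall e, c e \in [:: -2; -1; 0; 1; 2]) -> ldivides f (comb s c) ->
  {in s, forall e, c e = 0}.
Proof.
move=> C1 us sk cs; have [g gE ->] := comb_dilate c us sk => /ldivides_monom fg e es.
have [g0|/C1] := eqVneq (dilate m g) 0; last first.
  by case=> // n; rewrite gE; case: ifP.
have := gE (quo e); rewrite -(sk e es) -quo_cls es => <-.
by rewrite -dilate_coef g0 raddf0.
Qed.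

Lemma good_C1_monom f n n' : good_C1 m f -> cls n = cls n' -> n != n' ->
  ~ ldivides f (lmonom n - lmonom n').
Proof.
move=> C1 nn' neq fnn.
pose c e : int := (e == n)%:R - (e == n')%:R.
have : c n = 0.
  apply: (@good_C1_comb f (cls n') [:: n; n'] c C1).
  - by rewrite /= inE neq.
  - by move=> e; rewrite !inE => /orP[] /eqP ->.
  - by move=> e; rewrite /c; case: eqP; case: eqP.
  - rewrite /comb !big_cons big_nil addr0 /c !eqxx (negPf neq) eq_sym (negPf neq) /=.
    by rewrite (_ : 1%:R - 0%:R = 1)// (_ : 0%:R - 1%:R = -1)// mulrN1z.
  - by rewrite mem_head.
by rewrite /c eqxx (negPf neq).
Qed.

(** Translation by [- k] brings [s] into the class of [0] and [n], [n'] into a common nonzero class,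
    where (C2) applies. If the combination is zero, (C2) is silent and (C1) is used instead. *)
Lemma good_C2_comb f k s c n n' : good_C1 m f -> good_C2 m f ->
  uniq s -> {in s, forall e, cls e = k} -> cls k = k ->
  (forall e, c e \in [:: -1; 0; 1]) ->
  cls n = cls n' -> cls n != k -> n != n' ->
  ~ ldivides f (lmonom n - lmonom n' + comb s c).
Proof.
move=> C1 C2 us sk kk cs nn' nk neq.
have [g gE ->] := comb_dilate c us sk; have [->|g0] := eqVneq g 0.
  by rewrite dilate0 mulr0 addr0; exact: good_C1_monom.
have shift e : lmonom e = lmonom k * lmonom (quo (e - k) *+ m + cls (e - k)) :> laurent d.
  by rewrite -quo_cls -lmonomD addrC subrK.
rewrite (shift n) (shift n') -mulrBr -mulrDr (cls_subr k nn') => /ldivides_monom.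
apply: C2 => //.
- by move=> j; exact: cls_ge0_lt.
- apply: contraNneq nk => n'k0; rewrite nn' -[X in _ == X]kk -[n'](subrK k).
  rewrite (@cls_addr _ 0) ?add0r// n'k0.
  by apply/rowP => j; rewrite !mxE mod0z.
- apply: contraNneq neq => qq; apply/eqP/(addIr (- k)).
  by rewrite (quo_cls (n - k)) (quo_cls (n' - k)) qq (cls_subr k nn').
- by move=> l; rewrite gE; case: ifP.
Qed.

End Goodness.

(** * Orthogonality and Riesz products *)

(** Expanding the square leaves only the diagonal terms, each at most [(M * D) ^+ 2] times the total
    weight. *)
Lemma orthogonal_second_moment (C : numClosedFieldType) (I : finType) (J : eqType)
    (W : I -> C) (s : seq J) (Y : J -> I -> C) (w : J -> C) (M D : C) :
  (forall i, 0 <= W i) -> uniq s -> 0 <= D ->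
  (forall n, `|w n| <= M) -> (forall n i, `|Y n i| <= D) ->
  {in s &, forall n n', n != n' -> \sum_i W i * (Y n i * (Y n' i)^*) = 0} ->
  \sum_i W i * `|\sum_(n <- s) w n * Y n i| ^+ 2 <=
    (M * D) ^+ 2 * (size s)%:R * \sum_i W i.
Proof.
move=> W0 us D0 wM YD orth.
have -> : \sum_i W i * `|\sum_(n <- s) w n * Y n i| ^+ 2 =
    \sum_(n <- s) \sum_i W i * `|w n * Y n i| ^+ 2.
  transitivity (\sum_(n <- s) \sum_(n' <- s)
      w n * (w n')^* * \sum_i W i * (Y n i * (Y n' i)^*)).
    transitivity (\sum_i \sum_(n <- s) \sum_(n' <- s)
        W i * (w n * Y n i * (w n' * Y n' i)^*)).
      apply: eq_bigr => i _; rewrite normCK rmorph_sum mulr_suml mulr_sumr.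
      by apply: eq_bigr => n _; rewrite !mulr_sumr.
    rewrite exchange_big /=; apply: eq_bigr => n _.
    rewrite exchange_big /=; apply: eq_bigr => n' _; rewrite mulr_sumr.
    by apply: eq_bigr => i _; rewrite rmorphM /= [X in _ * X]mulrACA [LHS]mulrCA.
  rewrite big_seq [RHS]big_seq; apply: eq_bigr => n ns.
  rewrite (bigD1_seq n)//= [X in _ + X]big_seq_cond [X in _ + X]big1 ?addr0; last first.
    by move=> n' /andP[n's nn']; rewrite orth ?mulr0// eq_sym.
  rewrite mulr_sumr; apply: eq_bigr => i _.
  by rewrite mulrCA -!normCK normrM exprMn.
rewrite mulrAC mulr_natr -sum1_size -sumrMnr; apply: ler_sum => n _.
rewrite mulr1n mulr_sumr; apply: ler_sum => i _; rewrite mulrC ler_wpM2r//.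
rewrite lerXn2r ?nnegrE ?normr_ge0 ?mulr_ge0// ?(le_trans _ (wM n))//.
by rewrite normrM ler_pM.
Qed.

Section RieszProducts.
Variables (R : realType) (d : nat) (I : finType).
Local Notation T := (circle R).
Local Notation C := R[i].
Local Notation Zd := 'rV[int]_d.
Variables (x : I -> Zd -> T) (a : Zd -> C).
Hypothesis a_le : forall e, `|a e| <= 2^-1.
Implicit Types (u v : laurent d) (n e : Zd) (s : seq Zd) (c : Zd -> int).

Definition riesz s (y : Zd -> T) : C :=
  \prod_(e <- s) (1 + a e * chi y (lmonom e) + (a e * chi y (lmonom e))^*).

Lemma norm_chi (y : Zd -> T) u : `|chi y u| = 1.
Proof. exact: norm_cis. Qed.

(** As [a e] has modulus at most 1/2, the real number 2 Re(a_e chi_e) is at least -1, so every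
    factor is nonnegative. *)
Lemma riesz_ge0 s (y : Zd -> T) : 0 <= riesz s y.
Proof.
apply: prodr_ge0 => e _; set t := a e * _.
have tle : `|t| <= 2^-1 by rewrite normrM norm_chi mulr1.
have treal : t + t^* \is Num.real by apply/CrealP; rewrite rmorphD /= conjCK addrC.
rewrite -addrA -lerBlDl sub0r; apply: real_lerNnormlW => //.
by rewrite (le_trans (ler_normD _ _))// norm_conjC [leRHS]splitr div1r lerD.
Qed.

Definition signs c := forall e, c e \in [:: -1; 0; 1].

Lemma comb_cons e s c : comb (e :: s) c = lmonom e *~ c e + comb s c.
Proof. by rewrite /comb big_cons. Qed.

Lemma eq_comb s c c' : {in s, c =1 c'} -> comb s c = comb s c'.
Proof.
by move=> cc'; rewrite /comb big_seq [RHS]big_seq; apply: eq_bigr => e /cc' ->.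
Qed.

Definition upd c e (j : int) : Zd -> int := fun e' => if e' == e then j else c e'.

Lemma signs_upd c e j : signs c -> j \in [:: -1; 0; 1] -> signs (upd c e j).
Proof. by move=> cs js e'; rewrite /upd; case: eqP. Qed.

Lemma comb_upd e s c j : e \notin s ->
  comb (e :: s) (upd c e j) = lmonom e *~ j + comb s c.
Proof.
move=> es; rewrite comb_cons {1}/upd eqxx; congr (_ + _); apply: eq_comb => e' e's.
by rewrite /upd; case: eqP => // ee; rewrite -ee e's in es.
Qed.

(** The Fourier coefficient at [u] of the measure on the points [x i] whose density is the Riesz
    product, not divided by [#|I|]. *)
Definition fourier s u : C := \sum_i chi (x i) u * riesz s (x i).

Lemma fourier_cons e s u : fourier (e :: s) u =
  fourier s u + a e * fourier s (u + lmonom e) + (a e)^* * fourier s (u - lmonom e).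
Proof.
rewrite /fourier !mulr_sumr -!big_split /=; apply: eq_bigr => i _.
rewrite /riesz big_cons chiB chiD; set P := \prod_(_ <- _) _.
rewrite rmorphM /= !mulrDl mul1r !mulrDr.
by congr (_ + _ + _); rewrite !mulrA [chi _ u * _]mulrC.
Qed.

(** Expanding the product one factor at a time yields a combination of the character sums at
    [u + comb s c], with [c] a sign pattern. *)
Lemma fourier_eq0 s u : uniq s ->
  (forall c, signs c -> \sum_i chi (x i) (u + comb s c) = 0) -> fourier s u = 0.
Proof.
elim: s u => [|e s IH] u.
  move=> _ /(_ (fun=> 0)); rewrite /comb big_nil addr0 => h.
  by rewrite /fourier -[RHS]h//; apply: eq_bigr => i _; rewrite /riesz big_nil mulr1.
move=> /= /andP[es us] H; rewrite fourier_cons.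
have step j : j \in [:: -1; 0; 1] -> fourier s (u + lmonom e *~ j) = 0.
  move=> js; apply: IH => // c cs.
  by rewrite -addrA -comb_upd//; apply: H; exact: signs_upd.
have := step 0 isT; rewrite mulr0z addr0 => ->.
have := step 1 isT; rewrite mulr1z => ->.
by have := step (-1) isT; rewrite mulrN1z => ->; rewrite !mulr0 !addr0.
Qed.

(** The coefficient with which the factor of [e] contributes the frequency [lmonom e *~ j]. *)
Definition weight e (j : int) : C :=
  if j == 1 then a e else if j == -1 then (a e)^* else 1.

(** In the same expansion only the pattern agreeing with [c0] on [s] survives, and it carries the
    product of its weights. *)
Lemma fourier_coef s u c0 : uniq s -> signs c0 ->
  (forall c, signs c -> \sum_i chi (x i) (u + comb s c) =
     if all (fun e => c e == c0 e) s then #|I|%:R else 0) ->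
  fourier s u = #|I|%:R * \prod_(e <- s) weight e (c0 e).
Proof.
move=> us c0s; elim: s u us => [|e s IH] u.
  move=> _ /(_ _ c0s); rewrite /comb /= !big_nil addr0 mulr1 => <-.
  by apply: eq_bigr => i _; rewrite /riesz big_nil mulr1.
move=> /= /andP[es us] H; rewrite fourier_cons.
have allE c j : all (fun e' => upd c e j e' == c0 e') s = all (fun e' => c e' == c0 e') s.
  apply: eq_in_all => e' e's; rewrite /upd.
  by have [ee|//] := eqVneq e' e; rewrite -ee e's in es.
have step j : j \in [:: -1; 0; 1] -> fourier s (u + lmonom e *~ j) =
    if j == c0 e then #|I|%:R * \prod_(e <- s) weight e (c0 e) else 0.
  move=> js; have H' c : signs c -> \sum_i chi (x i) (u + lmonom e *~ j + comb s c) =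
      if (j == c0 e) && all (fun e' => c e' == c0 e') s then #|I|%:R else 0.
    move=> cs; rewrite -addrA -comb_upd// H; last exact: signs_upd.
    by rewrite allE {1}/upd eqxx.
  case: eqP H' => /= [_|_] H'; first exact: IH.
  exact: fourier_eq0.
have := step 0 isT; rewrite mulr0z addr0 => ->.
have := step 1 isT; rewrite mulr1z => ->.
have := step (-1) isT; rewrite mulrN1z => ->; rewrite big_cons /weight.
have := c0s e; rewrite !inE => /or3P[] /eqP ->; rewrite /= ?mulr0 ?addr0 ?add0r ?mul1r//.
  by rewrite mulrCA.
by rewrite mulrCA.
Qed.

Lemma fourier_conj s u : (fourier s u)^* = fourier s (- u).
Proof.
rewrite /fourier rmorph_sum; apply: eq_bigr => i _.
rewrite /= rmorphM chiN; congr (_ * _).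
by apply/CrealP; rewrite ger0_real// riesz_ge0.
Qed.

End RieszProducts.

(** A list containing all signed combinations, in the form needed by averages that are built to kill
    a finite list of characters. *)
Fixpoint combs d (s : seq 'rV[int]_d) : seq (laurent d) :=
  if s is e :: s' then
    [seq lmonom e *~ j + v | j <- [:: -1; 0; 1], v <- combs s']
  else [:: 0].

Lemma comb_combs d (s : seq 'rV[int]_d) c : signs c -> comb s c \in combs s.
Proof.
move=> cs; elim: s => [|e s IH]; first by rewrite /comb big_nil mem_head.
rewrite comb_cons.
exact: (allpairs_f (fun j v => lmonom e *~ j + v) (cs e) IH).
Qed.

(** Otherwise every [Q i] exceeds [K], and an index of positive weight makes the weighted mean
    exceed [K]. Realness is assumed because the order on [C] is only partial. *)
Lemma weighted_mean_le (C : numFieldType) (I : finType) (W Q : I -> C) (K : C) :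
  (forall i, 0 <= W i) -> 0 < \sum_i W i -> (forall i, Q i \is Num.real) ->
  K \is Num.real -> \sum_i W i * Q i <= K * \sum_i W i -> exists i, Q i <= K.
Proof.
move=> W0 Wsum Qr Kr QK; apply/existsP; apply: contraTT QK.
rewrite negb_exists => /forallP nQ.
have KQ i : K < Q i by rewrite real_ltNge.
have [i Wi] : exists i, 0 < W i.
  apply/existsP; apply: contraTT Wsum; rewrite negb_exists => /forallP nW.
  rewrite big1 ?ltxx// => i _; apply/eqP; have := nW i; rewrite lt0r W0 andbT.
  by move/negPn.
rewrite -real_ltNge ?rpred_sum// ?realM// ?gtr0_real// => [|j _]; last first.
  by rewrite realM// ger0_real.
rewrite mulr_sumr (bigD1 i)//= [ltRHS](bigD1 i)//= ltr_leD//.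
  by rewrite mulrC ltr_pM2l.
by apply: ler_sum => j _; rewrite mulrC ler_wpM2l// ltW.
Qed.

(** * Fourier coefficients of the Riesz product on one residue class *)

Section RieszFamily.
Variables (R : realType) (d m : nat) (f : laurent d).
Hypotheses (m_gt0 : (0 < m)%N) (C1 : good_C1 m f) (C2 : good_C2 m f).
Local Notation T := (circle R).
Local Notation C := R[i].
Local Notation Zd := 'rV[int]_d.
Implicit Types (u v : laurent d) (n e k : Zd) (s : seq Zd) (c : Zd -> int).

Lemma exists_killing_points (U V : seq (laurent d)) :
  exists (I : finType) (x : I -> Zd -> T),
    [/\ (0 < #|I|)%N, forall i, principal_set f (x i) &
        forall u v, u \in U -> v \in V -> ~ ldivides f (u + v) ->
          \sum_i chi (x i) (u + v) = 0].
Proof.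
pose S := [seq w <- [seq u + v | u <- U, v <- V] | `[< ~ ldivides f w >]].
have [|I [x [I0 xf xS]]] := @averaging_points R d f S.
  by move=> w; rewrite mem_filter => /andP[/asboolP].
exists I, x; split=> // u v uU vV nuv; apply: xS.
by rewrite mem_filter (allpairs_f (fun u v => u + v) uU vV) andbT; apply/asboolP.
Qed.

Lemma combB s c c' : comb s (fun e => c e - c' e) = comb s c - comb s c'.
Proof. by rewrite /comb -sumrB; apply: eq_bigr => e _; rewrite mulrzBr. Qed.

Lemma comb0 s : comb s (fun=> 0) = 0.
Proof. by rewrite /comb big1// => e _; rewrite mulr0z. Qed.

Lemma comb_delta s n : uniq s -> n \in s -> comb s (fun e => (e == n)%:R) = lmonom n.
Proof.
move=> us ns; rewrite /comb (bigD1_seq n)//= eqxx mulr1z big1 ?addr0// => e /negPf ->.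
by rewrite mulr0z.
Qed.

Variables (I : finType) (x : I -> Zd -> T) (a : Zd -> C).
Variables (k : Zd) (s : seq Zd) (U : seq (laurent d)).
Hypothesis (a_le : forall e, `|a e| <= 2^-1).
Hypotheses (us : uniq s) (sk : {in s, forall e, cls m e = k}) (kk : cls m k = k).
Hypothesis killU : forall u v, u \in U -> v \in combs s ->
  ~ ldivides f (u + v) -> \sum_i chi (x i) (u + v) = 0.
Local Notation F := (fourier x a s).

(** If [f] divides [comb s b - comb s c] for sign patterns [b] and [c], these agree on [s] by (C1);
    hence exactly one term of the expansion is not killed. *)
Lemma fourier_comb c : signs c -> - comb s c \in U ->
  F (- comb s c) = #|I|%:R * \prod_(e <- s) weight a e (c e).
Proof.
move=> cs cU; apply: fourier_coef => // b bs.
case: ifPn => [/allP bc|nbc].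
  rewrite (@eq_comb _ _ b c); last by move=> e /bc /eqP.
  under eq_bigr do rewrite addNr chi0.
  by rewrite sumr_const.
apply: killU => //; first exact: comb_combs.
rewrite addrC -combB => /(good_C1_comb m_gt0 C1 us sk) h.
apply/negP: nbc; apply/negPn/allP => e es; rewrite -subr_eq0; apply/eqP/h => // e'.
by move: (bs e') (cs e'); rewrite !inE => /or3P[] /eqP -> /or3P[] /eqP ->.
Qed.

Lemma fourier_one : 0 \in U -> F 0 = #|I|%:R.
Proof.
move=> U0; rewrite -[0]oppr0 -(comb0 s) fourier_comb ?comb0 ?oppr0//.
by rewrite big1 ?mulr1// => e _.
Qed.

Lemma fourier_monom n : n \in s -> lmonom n \in U -> F (lmonom n) = #|I|%:R * (a n)^*.
Proof.
(* The product must supply the frequency [- lmonom n] to cancel [lmonom n]; its weight is the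
   conjugate of [a n]. *)
move=> ns nU; pose c e : int := 0 - (e == n)%:R.
have cE : - comb s c = lmonom n.
  by rewrite /c combB comb_delta// comb0 sub0r opprK.
rewrite -cE fourier_comb ?cE//; last by move=> e; rewrite /c; case: eqP.
congr (_ * _); rewrite (bigD1_seq n)//= big1 ?mulr1; first by rewrite /c eqxx.
by move=> e /negPf en; rewrite /c en.
Qed.

(** Distinct characters of the class [k] behave as uncorrelated: the mean of chi_n times the
    conjugate of chi_n' is the product of their means. *)
Lemma fourier_monomB n n' : n \in s -> n' \in s -> n != n' ->
  lmonom n - lmonom n' \in U ->
  F (lmonom n - lmonom n') = #|I|%:R * ((a n)^* * a n').
Proof.
move=> ns n's neq nU; pose c e : int := (e == n')%:R - (e == n)%:R.
have cE : - comb s c = lmonom n - lmonom n' by rewrite /c combB !comb_delta// opprB.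
rewrite -cE fourier_comb ?cE//; last by move=> e; rewrite /c; do 2!case: eqP => _.
congr (_ * _); rewrite (bigD1_seq n)//= -big_filter (bigD1_seq n') ?filter_uniq//=.
  rewrite {1 2}/c !eqxx (negPf neq) eq_sym (negPf neq) big_filter_cond big1 ?mulr1//.
  by move=> e /andP[/negPf en /negPf en']; rewrite /c en en'.
by rewrite mem_filter eq_sym neq.
Qed.

Lemma fourier_other n n' : cls m n = cls m n' -> cls m n != k -> n != n' ->
  lmonom n - lmonom n' \in U -> F (lmonom n - lmonom n') = 0.
Proof.
move=> nn' nk neq nU; apply: fourier_eq0 => // c cs.
apply: killU => //; first exact: comb_combs.
exact: (good_C2_comb m_gt0 C1 C2 us sk kk cs nn' nk neq).
Qed.

(** In the class [k] the mean under the Riesz density is subtracted; in the other classes the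
    characters are already orthogonal by [fourier_other]. *)
Definition centered n (y : Zd -> T) : C :=
  chi y (lmonom n) - (if cls m n == k then (a n)^* else 0).

Lemma norm_centered n y : `|centered n y| <= 2.
Proof.
rewrite (le_trans (ler_normB _ _))// norm_chi -natr1 addrC lerD2r.
case: ifP; rewrite ?normr0// norm_conjC => _; apply: le_trans (a_le n) _.
by rewrite invf_le1 ?ler1n.
Qed.

(** Four Fourier coefficients arise. In the class [k] they are products of means and cancel; in
    another class only the one at [lmonom n - lmonom n'] remains, and it vanishes. *)
Lemma centered_orth n n' : cls m n = cls m n' -> n != n' ->
  (cls m n = k -> n \in s /\ n' \in s) ->
  0 \in U -> lmonom n \in U -> lmonom n' \in U -> lmonom n - lmonom n' \in U ->
  \sum_i riesz a s (x i) * (centered n (x i) * (centered n' (x i))^*) = 0.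
Proof.
move=> nn' neq ks U0 Un Un' Unn'.
pose al := if cls m n == k then (a n)^* else 0.
pose be := if cls m n == k then (a n')^* else 0.
transitivity (F (lmonom n - lmonom n') - be^* * F (lmonom n) - al * (F (lmonom n'))^*
    + al * be^* * F 0).
  rewrite (fourier_conj x a_le) /fourier !mulr_sumr -!sumrB -big_split /=.
  apply: eq_bigr => i _; rewrite /centered -nn' -/al -/be rmorphB /= chiB chiN chi0.
  set W := riesz _ _ _; set p := chi _ _; set q := (chi _ _)^*.
  ring.
have [kE|nk] := eqVneq (cls m n) k; last first.
  by rewrite fourier_other// /al /be (negPf nk) conjC0 !mul0r !subr0 addr0.
have [ns n's] := ks kE.
rewrite fourier_monomB// !fourier_monom// fourier_one// /al /be kE eqxx.
rewrite rmorphM /= !conjCK conjC_nat; ring.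
Qed.

End RieszFamily.

(** * Points of [X_f] with large weighted sums *)

(** By orthogonality within each class, the left side has Riesz mean at most the right side, so some
    sampling point does not exceed that bound. *)
Lemma good_point (R : realType) (d m : nat) (f : laurent d) (w a : 'rV[int]_d -> R[i])
    (M : R[i]) (lam : nat -> R[i]) (B : nat -> seq 'rV[int]_d)
    (k : 'rV[int]_d) (Ks : seq 'rV[int]_d) (Ns : seq nat) :
  (0 < m)%N -> good_C1 m f -> good_C2 m f -> cls m k = k ->
  (forall e, `|w e| <= M) -> (forall e, `|a e| <= 2^-1) ->
  (forall N, 0 <= lam N) -> (forall N, uniq (B N)) ->
  exists2 y : 'rV[int]_d -> circle R, principal_set f y &
    \sum_(N <- Ns) lam N * (\sum_(r <- Ks)
      `|\sum_(n <- B N | cls m n == r) w n * centered m a k n y| ^+ 2) <=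
    \sum_(N <- Ns) lam N * ((size Ks)%:R * ((M * 2) ^+ 2 * (size (B N))%:R)).
Proof.
move=> m0 C1 C2 kk wM a_le lam0 uB.
have M0 : 0 <= M := le_trans (normr_ge0 _) (wM 0).
(* A single Riesz product, over the class [k] in the union of all boxes, serves every [N] in [Ns] at
   once. *)
pose A := undup (flatten [seq B N | N <- Ns]).
pose s := [seq n <- A | cls m n == k].
have us : uniq s by rewrite filter_uniq ?undup_uniq.
have sk : {in s, forall e, cls m e = k} by move=> e; rewrite mem_filter => /andP[/eqP].
pose U : seq (laurent d) := 0 :: [seq lmonom n | n <- A] ++
  [seq lmonom n - lmonom n' | n <- A, n' <- A].
have [I [x [I0 xf killU]]] := exists_killing_points R f U (combs s).
have UA n : n \in A -> lmonom n \in U.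
  by move=> nA; rewrite inE mem_cat map_f ?orbT.
have UAA n n' : n \in A -> n' \in A -> lmonom n - lmonom n' \in U.
  move=> nA n'A; rewrite inE mem_cat.
  by rewrite (allpairs_f (fun n n' => lmonom n - lmonom n') nA n'A) !orbT.
pose W i := riesz a s (x i).
have W0 i : 0 <= W i by exact: riesz_ge0.
have Wsum : \sum_i W i = #|I|%:R.
  rewrite -(fourier_one m0 C1 a us sk killU) ?mem_head//.
  by rewrite /fourier; apply: eq_bigr => i _; rewrite chi0 mul1r.
pose Q (y : 'rV[int]_d -> circle R) := \sum_(N <- Ns) lam N * (\sum_(r <- Ks)
      `|\sum_(n <- B N | cls m n == r) w n * centered m a k n y| ^+ 2).
pose K := \sum_(N <- Ns) lam N * ((size Ks)%:R * ((M * 2) ^+ 2 * (size (B N))%:R)).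
suff [i Qi] : exists i, Q (x i) <= K by exists (x i).
apply: (weighted_mean_le W0).
- by rewrite Wsum ltr0n.
- move=> i; apply/ger0_real/sumr_ge0 => N _; rewrite mulr_ge0//.
  by apply: sumr_ge0 => r _; rewrite exprn_ge0.
- apply/ger0_real/sumr_ge0 => N _.
  by rewrite !mulr_ge0 ?exprn_ge0 ?mulr_ge0.
rewrite /Q /K mulr_suml; under eq_bigr do rewrite mulr_sumr.
rewrite exchange_big /= big_seq [leRHS]big_seq; apply: ler_sum => N NNs.
under eq_bigr do rewrite mulrCA; rewrite -mulr_sumr -mulrA ler_wpM2l//.
under [leLHS]eq_bigr do rewrite mulr_sumr.
rewrite exchange_big /= -mulrA -sum1_size natr_sum mulr_suml; apply: ler_sum => r _.
rewrite mul1r; under [leLHS]eq_bigr do rewrite -big_filter.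
have ur : uniq [seq n <- B N | cls m n == r] by rewrite filter_uniq.
have BA : {subset [seq n <- B N | cls m n == r] <= A}.
  move=> n; rewrite mem_filter => /andP[_ nB]; rewrite mem_undup.
  by apply/flattenP; exists (B N) => //; exact: map_f.
apply: le_trans (@orthogonal_second_moment _ _ _ W _
  (fun n i => centered m a k n (x i)) w M 2 W0 ur _ wM _ _) _ => //.
- by move=> n i; exact: norm_centered.
- move=> n n' nr n'r neq; have nA := BA _ nr; have n'A := BA _ n'r.
  move: nr n'r; rewrite !mem_filter => /andP[/eqP nr _] /andP[/eqP n'r _].
  apply: (centered_orth m0 C1 C2 a_le us sk kk killU) => //.
  + by rewrite nr n'r.
  + by move=> nk; rewrite !mem_filter nA n'A n'r -nr nk eqxx.
  + exact: mem_head.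
  + exact: UA.
  + exact: UA.
  + exact: UAA.
rewrite ler_wpM2r ?sumr_ge0// ler_wpM2l ?exprn_ge0 ?mulr_ge0//.
by rewrite ler_nat size_filter count_size.
Qed.

Lemma big_classes (V : nmodType) (J K : eqType) (t : J -> K) (Ks : seq K) (s : seq J)
    (F : J -> V) : uniq Ks -> (forall n, t n \in Ks) ->
  \sum_(n <- s) F n = \sum_(r <- Ks) \sum_(n <- s | t n == r) F n.
Proof.
move=> uK tK; under [RHS]eq_bigr do rewrite big_mkcond.
rewrite exchange_big /=; apply: eq_bigr => n _.
rewrite (bigD1_seq (t n))//= eqxx big1 ?addr0// => r.
by rewrite eq_sym => /negPf ->.
Qed.

(** Phase alignment makes the class [k] contribute half of its absolute weight, at least [c / 2],
    while the centred sums cost at most [c / 4] in total. Their second moments are bounded by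
    multiples of [nu N], whence the condition on the sum of the [nu N]. *)
Lemma large_sums (R : realType) (d m : nat) (f : laurent d) (w : 'rV[int]_d -> R[i])
    (M c : R[i]) (nu : nat -> R[i]) (B : nat -> seq 'rV[int]_d)
    (k : 'rV[int]_d) (Ks : seq 'rV[int]_d) :
  (0 < m)%N -> good_C1 m f -> good_C2 m f -> cls m k = k ->
  (forall e, `|w e| <= M) -> 0 < c ->
  (forall N, 0 <= nu N) -> (forall N, uniq (B N)) ->
  (forall N, nu N * (size (B N))%:R <= 1) ->
  uniq Ks -> (forall n, cls m n \in Ks) ->
  exists2 delta, 0 < delta & forall Ns, \sum_(N <- Ns) nu N <= delta ->
    exists2 y : 'rV[int]_d -> circle R, principal_set f y &
      forall N, N \in Ns -> c <= nu N * \sum_(n <- B N | cls m n == k) `|w n| ->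
        c / 4 <= nu N * `|\sum_(n <- B N) w n * chi y (lmonom n)|.
Proof.
move=> m0 C1 C2 kk wM c0 nu0 uB nuB uK clsK.
have M0 : 0 <= M := le_trans (normr_ge0 _) (wM 0).
pose L := (size Ks)%:R : R[i].
have L0 : 0 < L.
  by rewrite ltr0n; case: Ks clsK {uK L} => // /(_ 0).
(* The error allowed in each of the [L] classes, so that together they cost [c / 4]. *)
pose eta := c / (4 * L).
have eta0 : 0 < eta by rewrite divr_gt0// mulr_gt0.
have eta0' : 0 <= eta := ltW eta0.
(* The added [1] keeps [D] positive even when [M = 0]. *)
pose D := L * (M * 2) ^+ 2 + 1.
have D0 : 0 < D by rewrite ltr_wpDl// mulr_ge0 ?exprn_ge0 ?mulr_ge0// ltW.
exists (eta ^+ 2 / D) => [|Ns Nsd]; first by rewrite divr_gt0// exprn_gt0.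
(* Half the phase of [w e]; for [w e = 0] the quotient is [0] by convention, and [waE] still
   holds. *)
pose a e := w e / (2 * `|w e|).
have waE e : w e * (a e)^* = `|w e| / 2.
  rewrite /a rmorphM fmorphV rmorphM /= conj_normC conjC_nat mulrA -normCK.
  have [->|w0] := eqVneq `|w e| 0; first by rewrite expr0n !mul0r.
  by rewrite invfM expr2 -mulrA [X in _ * X]mulrCA mulfV// mulr1.
have a_le e : `|a e| <= 2^-1.
  rewrite /a normrM normfV normrM normr_nat normr_id invfM mulrCA.
  have [->|w0] := eqVneq `|w e| 0; first by rewrite mul0r mulr0 invr_ge0.
  by rewrite mulfV// mulr1.
have [y yf Qy] := good_point Ks Ns m0 C1 C2 kk wM a_le (fun N => exprn_ge0 2 (nu0 N)) uB.

(* One factor [nu N] absorbs the size of the box, so the total is at most [D] times the sum of the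
   [nu N]. *)
have Qle : \sum_(N <- Ns) nu N ^+ 2 * (L * ((M * 2) ^+ 2 * (size (B N))%:R)) <= eta ^+ 2.
  apply: le_trans (_ : D * (\sum_(N <- Ns) nu N) <= _); last first.
    by rewrite mulrC -ler_pdivlMr.
  rewrite mulr_sumr; apply: ler_sum => N _.
  rewrite expr2 -mulrA [leRHS]mulrC ler_wpM2l//.
  have -> : nu N * (L * ((M * 2) ^+ 2 * (size (B N))%:R)) =
      L * (M * 2) ^+ 2 * (nu N * (size (B N))%:R) by ring.
  rewrite (le_trans (_ : _ <= L * (M * 2) ^+ 2 * 1))//; last by rewrite mulr1 lerDl.
  by rewrite ler_wpM2l// mulr_ge0 ?exprn_ge0 ?mulr_ge0// ltW.
(* All terms are nonnegative, so each is bounded by the whole sum. *)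
have Dle N r : N \in Ns -> r \in Ks ->
    nu N * `|\sum_(n <- B N | cls m n == r) w n * centered m a k n y| <= eta.
  move=> NNs rK; rewrite -(@ler_pXn2r _ 2) ?nnegrE//; last by rewrite mulr_ge0.
  apply: le_trans Qle; apply: le_trans Qy.
  rewrite (big_rem N NNs)/= (big_rem r rK)/= exprMn mulrDr -addrA lerDl addr_ge0//.
    by rewrite mulr_ge0 ?exprn_ge0// sumr_ge0.
  by rewrite sumr_ge0// => N' _; rewrite mulr_ge0 ?exprn_ge0// sumr_ge0.
exists y => // N NNs cN.
have E : \sum_(n <- B N) w n * chi y (lmonom n) =
    (\sum_(n <- B N | cls m n == k) `|w n|) / 2 +
    \sum_(r <- Ks) \sum_(n <- B N | cls m n == r) w n * centered m a k n y.
  rewrite -big_classes// mulr_suml [X in _ = X + _]big_mkcond -big_split /=; apply: eq_bigr => n _.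
  rewrite /centered mulrBr; case: eqP => _; first by rewrite waE addrC subrK.
  by rewrite mulr0 subr0 add0r.
rewrite E; set X := _ / 2; set Y := \sum_(r <- Ks) _.
have nuY : nu N * `|Y| <= c / 4.
  apply: le_trans (_ : \sum_(r <- Ks) eta <= _); last first.
    rewrite big_const_seq count_predT iter_addr_0 -[leLHS]mulr_natl /eta -/L.
    by rewrite (_ : L * _ = c / 4)//; field; exact: lt0r_neq0.
  apply: le_trans (_ : nu N * (\sum_(r <- Ks)
    `|\sum_(n <- B N | cls m n == r) w n * centered m a k n y|) <= _).
    by rewrite ler_wpM2l// ler_norm_sum.
  rewrite mulr_sumr big_seq [leRHS]big_seq; apply: ler_sum => r rK.
  exact: Dle.
have nuX : c / 2 <= nu N * `|X|.
  rewrite ger0_norm; last by rewrite divr_ge0// sumr_ge0.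
  by rewrite mulrA ler_pM2r.
have tri : nu N * `|X| <= nu N * `|X + Y| + nu N * `|Y|.
  rewrite -mulrDr ler_wpM2l// -[X in `|X| <= _](addrK Y).
  exact: ler_normB.
have := le_trans nuX tri; rewrite -lerBlDr; apply: le_trans.
rewrite lerBrDr (le_trans (lerD (lexx _) nuY))//.
by rewrite [leRHS]splitr -mulrA -invfM -natrM.
Qed.

(** * Limits superior, pigeonhole and compactness *)

Lemma limn_esup_gt0P (R : realType) (u : nat -> R) :
  (0 < limn_esup (fun N => (u N)%:E))%E <->
  exists2 c, 0 < c & forall N0, exists2 N, (N0 <= N)%N & c <= u N.
Proof.
split=> [u0|[c c0 uc]]; last first.
  apply: (@lt_le_trans _ _ c%:E); first by rewrite lte_fin.
  apply: le_ereal_inf_tmp => _ [A [N0 _ NA] <-].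
  have [N N0N cN] := uc N0; apply: (@le_trans _ _ (u N)%:E); first by rewrite lee_fin.
  by apply: ereal_sup_ubound; exists N => //; exact: NA.
apply: contrapT => nex; suff : (limn_esup (fun N => (u N)%:E) <= 0)%E by rewrite leNgt u0.
apply/lee_addgt0Pr => e e0; rewrite add0e.
have [N0 uN] : exists N0, forall N, (N0 <= N)%N -> u N < e.
  apply: contrapT => nN0; apply: nex; exists e => // N0; apply: contrapT => nN.
  apply: nN0; exists N0 => N N0N; rewrite ltNge; apply/negP => eN.
  by apply: nN; exists N.
apply: (@le_trans _ _ (ereal_sup ((fun N => (u N)%:E) @` [set N | (N0 <= N)%N]))).
  by apply: ereal_inf_lbound; exists [set N | (N0 <= N)%N] => //; exists N0.
by apply: ge_ereal_sup => _ [N /= N0N <-]; rewrite lee_fin ltW// uN.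
Qed.

(** Either the first term is frequently at least [c / 2], or it is eventually smaller and the
    remaining sum is frequently at least [c / 2]. *)
Lemma frequently_pigeonhole (R : realFieldType) (J : eqType) (Ks : seq J)
    (A : nat -> J -> R) (c : R) : 0 < c ->
  (forall N0, exists2 N, (N0 <= N)%N & c <= \sum_(r <- Ks) A N r) ->
  exists c' r, [/\ 0 < c', r \in Ks & forall N0, exists2 N, (N0 <= N)%N & c' <= A N r].
Proof.
elim: Ks c => [|r Ks IH] c c0 freq.
  by have [N _] := freq 0%N; rewrite big_nil leNgt c0.
have [fr|nfr] := pselect (forall N0, exists2 N, (N0 <= N)%N & c / 2 <= A N r).
  by exists (c / 2), r; rewrite divr_gt0// mem_head.
have [|N0|c' [r' [c'0 r'K fr']]] := IH (c / 2); first by rewrite divr_gt0.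
  have /existsNP[N1 nN1] := nfr; have [N leN cN] := freq (maxn N0 N1).
  move: leN; rewrite geq_max => /andP[N0N N1N]; exists N => //.
  have : A N r < c / 2 by rewrite ltNge; apply/negP => h; apply: nN1; exists N.
  move: cN; rewrite big_cons {1}[c]splitr => h1 h2.
  by rewrite -(lerD2l (A N r)); apply: le_trans h1; rewrite lerD2r ltW.
by exists c', r'; rewrite inE r'K orbT.
Qed.

(** For fixed [j] the bound is a closed condition holding along the tail [J > j], so it passes to
    any cluster point of [x_]. *)
Lemma compact_norm_ge (C : numFieldType) (V : normedModType C) (X : topologicalType)
    (g : nat -> X -> V) (x_ : nat -> X) (c : C) :
  compact [set: X] -> (forall j, continuous (g j)) -> c \is Num.real ->
  (forall J j, (j < J)%N -> c <= `|g j (x_ J)|) -> exists x, forall j, c <= `|g j x|.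
Proof.
move=> cX cg cr gx.
have [x [_ xcl]] := cX (x_ @ \oo) _ filterT; exists x => j.
rewrite real_leNgt ?normr_real//; apply/negP => gc.
have e0 : 0 < c - `|g j x| by rewrite subr_gt0.
have /cvgrPdist_lt/(_ _ e0) near_x := cg j x.
have [|y [/= cy xy]] := xcl [set y | c <= `|g j y|] _ _ near_x.
  by exists j.+1 => // J /= jJ; exact: gx.
have : `|g j y| < c.
  rewrite -(subKr (g j x) (g j y)) (le_lt_trans (ler_normB _ _))//.
  by rewrite addrC -ltrBrDr.
by move=> /(le_lt_trans cy); rewrite ltxx.
Qed.

(** * Continuity of the characters on [X_f] *)

Section Continuity.
Variable R : realType.
Local Notation C := R[i].

Lemma norm_normc (z : C) : `|z| = (ComplexField.Normc.normc z)%:C%C.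
Proof. by []. Qed.

Lemma norm_complex_le (z : C) : `|z| <= (`|complex.Re z| + `|complex.Im z|)%:C%C.
Proof.
rewrite normc_def lecR -[leRHS]ger0_norm ?addr_ge0// -sqrtr_sqr ler_wsqrtr//.
rewrite sqrrD !real_normK ?num_real//.
by rewrite addrAC lerDl mulrn_wge0// mulr_ge0.
Qed.

Lemma cexp2pi_continuous : continuous (@cexp2pi R : R -> C^o).
Proof.
move=> t; apply/cvgrPdist_lt => e e0.
have [er eE] : exists er : R, e = er%:C%C.
  by exists (complex.Re e); rewrite -[LHS]RRe_real// gtr0_real.
have er0 : 0 < er / 2 by move: e0; rewrite eE ltcR => ?; rewrite divr_gt0.
have c1 : continuous (fun s : R => cos (2 * pi * s)).
  move=> s; apply: continuous_comp; last exact: continuous_cos.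
  exact: mulrl_continuous.
have c2 : continuous (fun s : R => sin (2 * pi * s)).
  move=> s; apply: continuous_comp; last exact: continuous_sin.
  exact: mulrl_continuous.
have /cvgrPdist_lt/(_ _ er0) n1 := c1 t.
have /cvgrPdist_lt/(_ _ er0) n2 := c2 t.
apply: filterS2 n1 n2 => s h1 h2.
apply: le_lt_trans (norm_complex_le _) _; rewrite eE ltcR [ltRHS]splitr.
exact: ltrD.
Qed.

Lemma cis_continuous : continuous (@cis R : circle R -> C^o).
Proof.
apply/quotient_continuous.
rewrite (_ : _ \o _ = @cexp2pi R); first exact: cexp2pi_continuous.
by apply/funext => t; exact: cis_pi.
Qed.

Variables (d : nat) (f : laurent d).

Lemma principal_coord_continuous (n : 'rV[int]_d) :
  continuous (fun x : principal_set (R := R) f => cis (val x n) : C^o).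
Proof.
move=> x.
apply: (@cvg_comp _ _ _ (fun u : principal_set (R := R) f => val u n) (@cis R : circle R -> C^o)
  _ (nbhs (val x n : circle R))); last exact: cis_continuous.
apply: (@cvg_comp _ _ _ (fun u : principal_set (R := R) f => val u) (fun u => u n)
  _ (nbhs (val x : {ptws 'rV[int]_d -> circle R}))).
  exact: (@initial_continuous (principal_set f) _ (fun u => val u)).
exact: (@proj_continuous _ (fun=> circle R) n).
Qed.

Lemma sum_continuous (X : topologicalType) (J : Type) (s : seq J) (w : J -> C)
    (g : J -> X -> C^o) : (forall j, continuous (g j)) ->
  continuous (fun x => \sum_(j <- s) w j * g j x : C^o).
Proof.
move=> cg x; elim: s => [|j s IH].
  by under eq_fun do rewrite big_nil; exact: cvg_cst.
under eq_fun do rewrite big_cons.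
apply: cvgD; last exact: IH.
apply: (@cvgM C); [exact: cvg_cst|exact: cg].
Qed.

End Continuity.

(** * Boxes in the lattice *)

Section Boxes.
Variable d : nat.

Definition box N : seq 'rV[int]_d := [seq @box_int d N n | n <- enum 'rV['I_N]_d].

Lemma box_int_inj N : injective (@box_int d N).
Proof.
move=> n n' /rowP nn'; apply/rowP => j; apply/val_inj.
by have := nn' j; rewrite !mxE => -[].
Qed.

Lemma box_uniq N : uniq (box N).
Proof. by rewrite map_inj_uniq ?enum_uniq//; exact: box_int_inj. Qed.

Lemma size_box N : size (box N) = (N ^ d)%N.
Proof. by rewrite size_map -cardE card_mx card_ord mul1n. Qed.

Lemma big_box (V : nmodType) N (F : 'rV[int]_d -> V) :
  \sum_(n : 'rV['I_N]_d) F (box_int n) = \sum_(e <- box N) F e.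
Proof. by rewrite big_map big_enum. Qed.

Lemma cls_box m n : (0 < m)%N -> cls m n \in box m.
Proof.
move=> m0; have nj (j : 'I_d) : (`|(n 0%R j %% m)%Z| < m)%N.
  by rewrite -ltz_nat gez0_abs ?modz_ge0 ?ltz_pmod// eqz_nat -lt0n.
apply/mapP; exists (\row_j Ordinal (nj j)); first by rewrite mem_enum.
by apply/rowP => j; rewrite !mxE /= gez0_abs// modz_ge0// eqz_nat -lt0n.
Qed.

Lemma cls_id m k : k \in box m -> cls m k = k.
Proof.
by move=> /mapP[n _ ->]; apply/rowP => j; rewrite !mxE modz_small//= ltz_nat ltn_ord.
Qed.

(** Extends weights from N^d to Z^d by composition; only the values on boxes matter, where absolute
    values change nothing. *)
Definition absmx : 'rV[int]_d -> 'rV[nat]_d := map_mx absz.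

Lemma absmx_box N (n : 'rV['I_N]_d) : absmx (box_int n) = box_nat n.
Proof. by apply/rowP => j; rewrite !mxE. Qed.

End Boxes.

(** * Sparse box sizes and the construction of the point *)

Lemma sum_half_pow (R : numFieldType) (e : R) J : 0 <= e ->
  \sum_(j <- iota 0 J) e / 2 ^+ j.+1 <= e.
Proof.
move=> e0; suff -> : \sum_(j <- iota 0 J) e / 2 ^+ j.+1 = e - e / 2 ^+ J.
  by rewrite gerBl divr_ge0// exprn_ge0.
elim: J => [|J IH]; first by rewrite big_nil expr0 divr1 subrr.
rewrite -addn1 iotaD big_cat /= IH big_seq1 add0n addn1 -addrA; congr (_ + _).
by rewrite addrC exprS; field; rewrite expf_neq0.
Qed.

Lemma invrX_small (R : realType) (d : nat) (e : R) : (0 < d)%N -> 0 < e ->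
  exists N0, forall N, (N0 <= N)%N -> N%:R ^- d <= e.
Proof.
move=> d0 e0; exists (Num.bound e^-1).+1 => N leN.
have N1 : (0 < N)%N by exact: leq_trans leN.
have eN : e^-1 <= N%:R.
  have := @archi_boundP R e^-1 (ltW _); rewrite invr_gt0 => /(_ e0) /ltW h.
  by apply: le_trans h _; rewrite ler_nat ltnW.
rewrite invf_ple ?posrE ?exprn_gt0 ?ltr0n//; apply: le_trans eN _.
by rewrite -{1}[N%:R]expr1 ler_weXn2l// ler1n.
Qed.

Theorem theorem5p1 (R : realType) (d : nat) (d_gt0 : (1 <= d)%N) (f : laurent d)
    (f_primitive : primitive f) (f_irreducible : irreducible f)
    (f_mahler : (0 < mahler R f)%E)
    (f_good : exists2 m : nat, (0 < m)%N & good m f) :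
  bohr_chaotic R (principal_system R f).
Proof.
move=> w [[M wM] /limn_esup_gt0P[c0 c0_gt0 w_freq]].
have [m m0 [_ _ C1 C2]] := f_good.
pose W e := w (absmx e).
have WE N (n : 'rV['I_N]_d) : w (box_nat n) = W (box_int n) by rewrite /W absmx_box.
(* The share of the class [r] in the average over the box of size [N]; some class keeps a positive
   share frequently. *)
pose A N r : R :=
  N%:R ^- d * \sum_(e <- box d N | cls m e == r) ComplexField.Normc.normc (W e).
have [|c [k [c_gt0 kB k_freq]]] := @frequently_pigeonhole R _ (box d m) A c0 c0_gt0.
  move=> N0; have [N N0N cN] := w_freq N0; exists N => //.
  apply: le_trans cN _; rewrite -mulr_sumr -big_classes ?box_uniq//; last first.
    by move=> n; exact: cls_box.
  by under eq_bigr do rewrite WE; rewrite (big_box _ (fun e => ComplexField.Normc.normc (W e))).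
pose nu N : R[i] := (N%:R ^- d)%:C%C.
have nu_ge0 N : 0 <= nu N by rewrite lecR invr_ge0 exprn_ge0.
have nu_size N : nu N * (size (box d N))%:R <= 1.
  rewrite -[_%:R](rmorph_nat (real_complex R)) -rmorphM lecR size_box natrX.
  have [->|N0] := eqVneq (N%:R ^+ d : R) 0; first by rewrite mulr0.
  by rewrite mulVf.
have norm_W e : `|W e| <= M%:C%C by rewrite norm_normc lecR; exact: wM.
have c_gt0C : 0 < c%:C%C :> R[i] by rewrite ltcR.
have [delta delta_gt0 large] := large_sums m0 C1 C2 (cls_id kB) norm_W c_gt0C
  nu_ge0 (box_uniq d) nu_size (box_uniq d m) (fun n => cls_box n m0).
have [e eE] : exists e : R, delta = e%:C%C.
  by exists (complex.Re delta); rewrite -[LHS]RRe_real// gtr0_real.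
have e_gt0 : 0 < e by move: delta_gt0; rewrite eE ltcR.
(* Sizes so sparse that [N%:R ^- d] sums to at most [delta] over any initial segment, with the class
   [k] carrying at least [c] at each of them. *)
have /choice[Nj NjP] : forall j : nat, exists N : nat,
    [/\ (j <= N)%N, N%:R ^- d <= e / 2 ^+ j.+1 & c <= A N k].
  move=> j; have [|N1 smallN] := @invrX_small R d (e / 2 ^+ j.+1) d_gt0.
    by rewrite divr_gt0// exprn_gt0.
  have [N] := k_freq (maxn j N1); rewrite geq_max => /andP[jN N1N] cN.
  by exists N; split=> //; exact: smallN.
(* A point serving the first [J] sizes simultaneously. *)
have exJ J : exists x : principal_set (R := R) f, forall j, (j < J)%N ->
    (c / 4)%:C%C <= nu (Nj j) * `|\sum_(n <- box d (Nj j)) W n * cis (val x n)|.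
  have [|y yf large_y] := large [seq Nj j | j <- iota 0 J].
    rewrite big_map eE -rmorph_sum lecR; apply: le_trans (sum_half_pow J (ltW e_gt0)).
    by apply: ler_sum => j _; have [] := NjP j.
  exists (SigSub (mem_set yf)) => j jJ.
  have [_ _ cj] := NjP j.
  have /large_y : Nj j \in [seq Nj j | j <- iota 0 J].
    by apply/map_f; rewrite mem_iota.
  rewrite rmorphM fmorphV rmorph_nat /=.
  under [X in `|X|]eq_bigr do rewrite /chi pairing_monom.
  apply; move: cj; rewrite -lecR /A rmorphM rmorph_sum; apply: le_trans.
  by [].
have [x_ x_P] := choice exJ.
pose g j (x : principal_set (R := R) f) : R[i]^o :=
  \sum_(n <- box d (Nj j)) (nu (Nj j) * W n) * cis (val x n).
have gE j x : `|g j x| = nu (Nj j) * `|\sum_(n <- box d (Nj j)) W n * cis (val x n)|.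
  rewrite -[in RHS](ger0_norm (nu_ge0 _)) -normrM mulr_sumr; congr (`|_|).
  by apply: eq_bigr => n _; rewrite mulrA.
(* A cluster point of these serves all the sizes. *)
have [||J j jJ|x gx] := @compact_norm_ge R[i] R[i]^o _ g x_ (c / 4)%:C%C
  (@principal_compact R d f).
- move=> j; apply: sum_continuous => n; exact: principal_coord_continuous.
- by rewrite ger0_real// lecR divr_ge0// ltW.
- by rewrite gE; exact: x_P.
(* With h(x) = e(x_0), the value of h at the translate of x by n is e(x_n). *)
exists (fun x : principal_set (R := R) f => cis (val x 0)), x; split.
  exact: principal_coord_continuous.
apply/limn_esup_gt0P; exists (c / 4); first by rewrite divr_gt0.
(* Since [j <= Nj j], the bound recurs at arbitrarily large sizes. *)
move=> N0; exists (Nj N0); first by have [] := NjP N0.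
have := gx N0; rewrite gE norm_normc -rmorphM lecR.
rewrite -(big_box _ (fun n => W n * cis (val x n))) => h.
apply: le_trans h _; rewrite le_eqVlt; apply/orP; left; apply/eqP; congr (_ * _).
congr ComplexField.Normc.normc; apply: eq_bigr => n _.
by rewrite WE /= /zd_shift add0r.
Qed.
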